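(* (Averaging effects) Let $D$ be a domain in $\mathbb{R}^n$ and $t_0\in\mathbb{R}$ be a real number. For any $x^0\in\mathbb{R}^n$, suppose that there exists a positive radius $r>0$ such that $B_r(x^0)\cap\overline{D}=\varnothing$ and $$u(x,t)\ge C_0>0\quad\text{in } D\times(t_0-r^{\frac{2s}{\alpha}},t_0+r^{\frac{2s}{\alpha}}].$$ Assume that $$u(x,t)\in\left(C^{1,1}_{\rm loc}(B_r(x^0))\cap\mathcal{L}_{2s}(\mathbb{R}^n)\right)\times\left(C^1([t_0-r^{\frac{2s}{\alpha}},t_0+r^{\frac{2s}{\alpha}}])\cap\mathcal{L}^-_\alpha(\mathbb{R})\right)$$ is lower semi-continuous in $x$ on $\overline{B_r(x^0)}$, satisfying $$\begin{cases}\partial_t^\alpha u(x,t)+(-\Delta)^s u(x,t)\ge-\varepsilon, & (x,t)\in B_r(x^0)\times(t_0-r^{\frac{2s}{\alpha}},t_0+r^{\frac{2s}{\alpha}}],\\ u(x,t)\ge 0, & (x,t)\in B_r^c(x^0)\times(t_0-r^{\frac{2s}{\alpha}},t_0+r^{\frac{2s}{\alpha}}],\\ u(x,t)\ge 0, & (x,t)\in B_r(x^0)\times(-\infty,t_0-r^{\frac{2s}{\alpha}}],\end{cases}$$ for some sufficiently small $\varepsilon>0$. Then there exists a positive constant $$C_1=C_1\left(\alpha,n,s,C_0,\operatorname{diam}(D),\operatorname{dist}(x^0,D)\right)$$ such that $$u(x^0,t_0)\ge C_1>0.$$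
   Context: Here $0<s<1$ and $0<\alpha<1$. $B_r(x^0)$ is the ball of radius $r$ centred at $x^0$ in $\mathbb{R}^n$, and $B_r^c(x^0)=\mathbb{R}^n\setminus B_r(x^0)$. $\operatorname{diam}(D)$ is the diameter of the domain $D$, and $\operatorname{dist}(x^0,D)$ is the distance from the point $x^0$ to $D$. Marchaud fractional derivative of order $\alpha\in(0,1)$: $\partial_t^\alpha u(x,t)=C_\alpha\int_{-\infty}^t\frac{u(x,t)-u(x,\tau)}{(t-\tau)^{1+\alpha}}\,d\tau$, with $C_\alpha=\frac{\alpha}{\Gamma(1-\alpha)}$. Fractional Laplacian, $0<s<1$: $(-\Delta)^s u(x,t)=C_{n,s}\,\mathrm{P.V.}\int_{\mathbb{R}^n}\frac{u(x,t)-u(y,t)}{|x-y|^{n+2s}}\,dy$, with $C_{n,s}>0$ a normalization constant and P.V. the Cauchy principal value. $\mathcal{L}_{2s}(\mathbb{R}^n)$ is the set of $v\in L^1_{\rm loc}(\mathbb{R}^n)$ with $\int_{\mathbb{R}^n}\frac{|v(x)|}{1+|x|^{n+2s}}\,dx<\infty$. $\mathcal{L}^-_\alpha(\mathbb{R})$ is the set of $g\in L^1_{\rm loc}(\mathbb{R})$ with $\int_{-\infty}^t\frac{|g(\tau)|}{1+|\tau|^{1+\alpha}}\,d\tau<\infty$ for every $t\in\mathbb{R}$. The notation $u(x,t)\in X\times Y$ means that $u(\cdot,t)\in X$ (regularity in $x$) and $u(x,\cdot)\in Y$ (regularity in $t$); here $C^1([a,b])$ refers to the restriction to $[a,b]$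.
   Formalization: As stated the claim fails: C_1 → 0 as r → 0, or for thin D. Here C_1 and ε may also depend on r and |D| (on D and x^0 themselves if D is unbounded), and lower semi-continuity in x is assumed uniformly in t on the time interval, since for each t separately it does not suffice. *)

(* Defs.v *)
From HB Require Import structures.
From mathcomp Require Import all_boot all_order all_algebra.
From mathcomp Require Import all_classical all_reals all_analysis.

Set Implicit Arguments.
Unset Strict Implicit.
Unset Printing Implicit Defensive.

Import Order.TTheory GRing.Theory Num.Theory.
Import numFieldNormedType.Exports.

Local Open Scope classical_set_scope.
Local Open Scope ring_scope.

(* R^n is 'rV[R]_n, with the sigma-algebra generated by the coordinates (the
   Borel one) and the Lebesgue measure built from that of R by iterated
   products: lebesgue_rV_box below computes the measure of boxes. *)
Definition rV_display : measure_display.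
Proof. exact: (measure_tuple_display default_measure_display). Qed.

Section rV_measurable.
Variables (R : realType) (n : nat).

Definition rV_coord (i : 'I_n) (x : 'rV[R]_n) : measurableTypeR R := x ord0 i.

Let rV_set0 : g_sigma_preimage rV_coord set0.
Proof. exact: sigma_algebra0. Qed.

Let rV_setC A : g_sigma_preimage rV_coord A -> g_sigma_preimage rV_coord (~` A).
Proof. exact: sigma_algebraC. Qed.

Let rV_bigcup (F : (set 'rV[R]_n)^nat) :
  (forall i, g_sigma_preimage rV_coord (F i)) ->
  g_sigma_preimage rV_coord (\bigcup_i (F i)).
Proof. exact: sigma_algebra_bigcup. Qed.

HB.instance Definition _ := @isMeasurable.Build rV_display 'rV[R]_n
  (g_sigma_preimage rV_coord) rV_set0 rV_setC rV_bigcup.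

Lemma measurable_rV_coord i : measurable_fun setT (rV_coord i).
Proof.
move=> _ Y mY; rewrite setTI; apply: sub_sigma_algebra => /=.
rewrite -bigcup_seq/=; exists i => /=; first by rewrite mem_index_enum.
by exists Y => //; rewrite setTI.
Qed.

Lemma measurable_fun_rV d (T : measurableType d) (f : T -> 'rV[R]_n) :
  (forall i, measurable_fun setT (rV_coord i \o f)) -> measurable_fun setT f.
Proof.
move=> mf _ Y mY; rewrite setTI.
have : image_set_system setT f measurable Y.
  move: Y mY; apply: smallest_sub; first by apply: sigma_algebra_image; exact: sigma_algebra_measurable.
  elim/big_ind: _ => [|A B sA sB|i _]; first exact: sub0set.
    by rewrite subUset; split.
  move=> _ [B mB <-]; rewrite /image_set_system/= !setTI.
  by have := mf i measurableT B mB; rewrite setTI.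
by rewrite /image_set_system/= setTI.
Qed.

End rV_measurable.
Section lebesgue_rV.
Variable R : realType.

Definition rV_cons n (p : measurableTypeR R * 'rV[R]_n) : 'rV[R]_n.+1 :=
  row_mx p.1%:M p.2 : 'rV[R]_(1 + n).

Fixpoint lebesgue_rV n : set 'rV[R]_n -> \bar R :=
  if n is m.+1 then pushforward (lebesgue_measure \x @lebesgue_rV m)%E (@rV_cons m)
  else dirac (0 : 'rV[R]_0).

Lemma rV_coord_cons0 n p : rV_coord ord0 (@rV_cons n p) = p.1.
Proof.
rewrite /rV_coord (_ : ord0 = lshift n (ord0 : 'I_1)); last exact/val_inj.
by apply: (etrans (row_mxEl _ _ _ _)); rewrite mxE.
Qed.

Lemma rV_coord_consS n p (j : 'I_n) :
  rV_coord (rshift 1 j : 'I_n.+1) (@rV_cons n p) = rV_coord j p.2.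
Proof. exact: row_mxEr. Qed.

Lemma measurable_rV_cons n : measurable_fun setT (@rV_cons n).
Proof.
apply: measurable_fun_rV => i; case: (@split_ordP 1 n i) => j ->.
- rewrite (_ : _ \o _ = fst); first exact: measurable_fst.
  apply/funext => p; rewrite -(rV_coord_cons0 p) /=; congr rV_coord.
  by apply/val_inj; rewrite /= ord1.
- rewrite (_ : _ \o _ = rV_coord j \o snd).
    by apply: measurableT_comp; [exact: measurable_rV_coord|exact: measurable_snd].
  by apply/funext => p; exact: rV_coord_consS.
Qed.

Lemma measurable_rV_head n : measurable_fun setT (@rV_coord R n.+1 ord0).
Proof. exact: measurable_rV_coord. Qed.

Lemma measurable_rV_behead n :
  measurable_fun setT (fun x : 'rV[R]_n.+1 => rsubmx (x : 'rV[R]_(1 + n))).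
Proof.
apply: measurable_fun_rV => j.
rewrite (_ : _ \o _ = rV_coord (rshift 1 j : 'I_n.+1)).
  exact: measurable_rV_coord.
by apply/funext => x; rewrite /rV_coord/= mxE.
Qed.

Lemma rV_headK n (p : measurableTypeR R * 'rV[R]_n) :
  (rV_coord ord0 (rV_cons p), rsubmx (rV_cons p : 'rV[R]_(1 + n))) = p.
Proof.
case: p => x y; congr pair; first exact: rV_coord_cons0.
exact: row_mxKr.
Qed.

Section step.
Variables (n : nat) (m : {sigma_finite_measure set 'rV[R]_n -> \bar R}).

Let nuM : {measure set 'rV[R]_n.+1 -> \bar R} :=
  @measure_function_pushforward__canonical__measure_function_Measure
   _ _ _ _ R (lebesgue_measure \x m)%E _ (@measurable_rV_cons n).

Definition rV_cons_measure : set 'rV[R]_n.+1 -> \bar R :=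
  pushforward (lebesgue_measure \x m)%E (@rV_cons n).

HB.instance Definition _ := isMeasure.Build _ _ _ rV_cons_measure
  (measure0 nuM) (measure_ge0 nuM) (@measure_semi_sigma_additive _ _ _ nuM).

Let sigma_finite_rV_cons_measure : sigma_finite setT rV_cons_measure.
Proof.
have /sigma_finiteP[F [TF ndF Foo]] := sigma_finiteT (@lebesgue_measure R).
have /sigma_finiteP[G [TG ndG Goo]] := sigma_finiteT m.
pose uncons (x : 'rV[R]_n.+1) := (rV_coord ord0 x, rsubmx (x : 'rV[R]_(1 + n))).
exists (fun k => uncons @^-1` (F k `*` G k)).
  apply/seteqP; split=> // x _.
  have [i _ Fi] : (\bigcup_k F k) (uncons x).1 by rewrite -TF.
  have [j _ Gj] : (\bigcup_k G k) (uncons x).2 by rewrite -TG.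
  exists (maxn i j) => //; split.
    by move: Fi; exact/subsetPset/ndF/leq_maxl.
  by move: Gj; exact/subsetPset/ndG/leq_maxr.
move=> k; have [mF Fk] := Foo k; have [mG Gk] := Goo k; split.
  rewrite -[X in measurable X]setTI.
  apply: (measurable_fun_pair (@measurable_rV_head n) (@measurable_rV_behead n)) => //.
  exact: measurableX.
rewrite /rV_cons_measure /pushforward -comp_preimage (_ : _ \o _ = id).
  by rewrite preimage_id product_measure1E// lte_mul_pinfty// ge0_fin_numE.
by rewrite funeqE => q /=; exact: rV_headK.
Qed.

HB.instance Definition _ := Measure_isSigmaFinite.Build _ _ _ rV_cons_measure
  sigma_finite_rV_cons_measure.

End step.

Lemma lebesgue_rV_sigma_finite_measure n :
  exists m : {sigma_finite_measure set 'rV[R]_n -> \bar R}, @lebesgue_rV n = m.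
Proof.
elim: n => [|n [m IH]]; first by exists (dirac (0 : 'rV[R]_0)).
by exists (rV_cons_measure m); rewrite /= IH.
Qed.

Section instances.
Variable n : nat.

Let lebesgue_rV0 : @lebesgue_rV n set0 = 0%E.
Proof. by have [m ->] := lebesgue_rV_sigma_finite_measure n; rewrite measure0. Qed.

Let lebesgue_rV_ge0 A : (0 <= @lebesgue_rV n A)%E.
Proof. by have [m ->] := lebesgue_rV_sigma_finite_measure n. Qed.

Let lebesgue_rV_semi_sigma_additive : semi_sigma_additive (@lebesgue_rV n).
Proof.
have [m ->] := lebesgue_rV_sigma_finite_measure n.
exact: measure_semi_sigma_additive.
Qed.

HB.instance Definition _ := isMeasure.Build _ _ _ (@lebesgue_rV n)
  lebesgue_rV0 lebesgue_rV_ge0 lebesgue_rV_semi_sigma_additive.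

Let lebesgue_rV_sigma_finite : sigma_finite setT (@lebesgue_rV n).
Proof.
have [m ->] := lebesgue_rV_sigma_finite_measure n; exact: sigma_finiteT.
Qed.

HB.instance Definition _ := Measure_isSigmaFinite.Build _ _ _ (@lebesgue_rV n)
  lebesgue_rV_sigma_finite.

End instances.

Lemma measurable_rV_box n (a b : 'rV[R]_n) :
  measurable [set x : 'rV[R]_n | forall i, a ord0 i <= x ord0 i <= b ord0 i].
Proof.
rewrite (_ : mkset _ = \big[setI/setT]_(i < n)
    (rV_coord i @^-1` `[a ord0 i, b ord0 i]%classic)).
  apply: bigsetI_measurable => i _; rewrite -[X in measurable X]setTI.
  exact: measurable_rV_coord.
rewrite -bigcap_seq; apply/seteqP; split=> x /= H i.
  by move=> _; rewrite /= in_itv/=; exact: H.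
by have := H i; rewrite /= mem_index_enum in_itv/=; exact.
Qed.

Lemma lebesgue_rV_box n (a b : 'rV[R]_n) : (forall i, a ord0 i <= b ord0 i) ->
  @lebesgue_rV n [set x : 'rV[R]_n | forall i, a ord0 i <= x ord0 i <= b ord0 i] =
  (\prod_i (b ord0 i - a ord0 i))%:E.
Proof.
elim: n a b => [|n IH] a b ab.
  by rewrite big_ord0 /= diracE mem_set// => -[].
pose tl (x : 'rV[R]_n.+1) : 'rV[R]_n := \row_i x ord0 (rshift 1 i : 'I_n.+1).
have tlE x i : tl x ord0 i = x ord0 (rshift 1 i : 'I_n.+1) by rewrite mxE.
have boxE : @rV_cons n @^-1`
      [set x : 'rV[R]_n.+1 | forall i, a ord0 i <= x ord0 i <= b ord0 i] =
    `[a ord0 ord0, b ord0 ord0]%classic `*`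
    [set y : 'rV[R]_n | forall i, tl a ord0 i <= y ord0 i <= tl b ord0 i].
  have c0 x y : @rV_cons n (x, y) ord0 ord0 = x by exact: rV_coord_cons0.
  have cS x y i : @rV_cons n (x, y) ord0 (rshift 1 i : 'I_n.+1) = y ord0 i.
    exact: (rV_coord_consS (x, y)).
  apply/seteqP; split=> [[x y] /= H|[x y] /= [xab yab] i].
    split=> [|i]; first by rewrite in_itv/= -{1 2}(c0 x y); exact: H.
    by rewrite !tlE -(cS x y); exact: H.
  case: (@split_ordP 1 n i) => j ->; last by rewrite cS -!tlE; exact: yab.
  have -> : lshift n j = ord0 by apply/val_inj; rewrite /= ord1.
  by rewrite c0; move: xab; rewrite in_itv.
rewrite -[LHS]/((lebesgue_measure \x @lebesgue_rV n)%E (@rV_cons n @^-1` _)).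
transitivity ((lebesgue_measure \x @lebesgue_rV n)%E
    (`[a ord0 ord0, b ord0 ord0]%classic `*`
    [set y : 'rV[R]_n | forall i, tl a ord0 i <= y ord0 i <= tl b ord0 i])).
  by rewrite -boxE.
rewrite product_measure1E//; last exact: measurable_rV_box.
rewrite [X in (_ * X)%E](IH (tl a) (tl b)); last by move=> i; rewrite !tlE.
have LE : lebesgue_measure `[a ord0 ord0, b ord0 ord0]%classic =
    (b ord0 ord0 - a ord0 ord0)%:E.
  rewrite lebesgue_measure_itv/= lte_fin; case: ltgtP (ab ord0) => // -> _.
  by rewrite subrr.
rewrite [X in (X * _)%E]LE.
rewrite -EFinM big_ord_recl; congr (_ * _)%:E; apply: eq_bigr => i _.
by rewrite !tlE; congr (b _ _ - a _ _); apply/val_inj.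
Qed.

End lebesgue_rV.

Section euclidean.
Variables (R : realType) (n : nat).
Implicit Types (x y : 'rV[R]_n) (D : set 'rV[R]_n).

(* The norm `|x| of 'rV[R]_n is the sup norm, hence a separate definition. It
   induces the same topology, so open, closure, compact, differentiable and
   nbhs can be used as they are. *)
Definition enorm x : R := Num.sqrt (\sum_i x ord0 i ^+ 2).

Definition eball x (r : R) : set 'rV[R]_n := [set y | enorm (y - x) < r].

Definition ediam D : \bar R :=
  ereal_sup [set (enorm (x - y))%:E | x in D & y in D].

Definition epoint_dist x D : R := inf [set enorm (x - y) | y in D].

Definition is_domain D := [/\ D !=set0, open D & connected D].

End euclidean.

Section fractional_operators.
Variable R : realType.

Definition Gamma (z : R) : R :=
  \int[lebesgue_measure]_(x in `]0, +oo[) (x `^ (z - 1) * expR (- x)).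

Definition marchaud (alpha : R) (g : R -> R) (t : R) : R :=
  alpha / Gamma (1 - alpha) *
  \int[lebesgue_measure]_(tau in `]-oo, t[)
    ((g t - g tau) / (t - tau) `^ (1 + alpha)).

(* c is the normalization constant C_{n,s}; the limit is the principal value. *)
Definition frac_laplacian n (c s : R) (v : 'rV[R]_n -> R) (x : 'rV[R]_n) : R :=
  c * lim ((\int[@lebesgue_rV R n]_(y in ~` eball x e)
    ((v x - v y) / enorm (x - y) `^ (n%:R + 2 * s))) @[e --> 0^'+]).

End fractional_operators.

Section function_spaces.
Variable R : realType.

Definition L1_loc_rV n (v : 'rV[R]_n -> R) :=
  measurable_fun setT v /\
  forall K : set 'rV[R]_n, compact K ->
    (\int[@lebesgue_rV R n]_(x in K) `|v x|%:E < +oo)%E.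

Definition L_2s n (s : R) (v : 'rV[R]_n -> R) :=
  L1_loc_rV v /\
  (\int[@lebesgue_rV R n]_x
     (`|v x| / (1 + enorm x `^ (n%:R + 2 * s)))%:E < +oo)%E.

Definition L_alpha_minus (alpha : R) (g : R -> R) :=
  locally_integrable setT g /\
  forall t : R, (\int[lebesgue_measure]_(tau in `]-oo, t[)
     (`|g tau| / (1 + `|tau| `^ (1 + alpha)))%:E < +oo)%E.

Definition gradient n (v : 'rV[R]_n -> R) (x : 'rV[R]_n) : 'rV[R]_n :=
  \row_i 'D_(delta_mx 0 i) v x.

Definition C11_loc n (U : set 'rV[R]_n) (v : 'rV[R]_n -> R) :=
  (forall x, U x -> differentiable v x) /\
  forall K : set 'rV[R]_n, compact K -> K `<=` U ->
    exists L : R, forall x y, K x -> K y ->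
      enorm (gradient v x - gradient v y) <= L * enorm (x - y).

(* Only the restriction of g to [a, b] matters: the derivatives at the
   endpoints are one-sided. *)
Definition C1_segment (a b : R) (g : R -> R) :=
  exists g' : R -> R, {within `[a, b], continuous g'} /\
    forall t, t \in `[a, b] ->
      (fun tau => (g tau - g t) / (tau - t)) @ within `[a, b] t^' --> g' t.

(* Lower semicontinuity in x, uniform in t: the neighbourhood of x is the same
   for all t in J. When u x is continuous on a compact J for every x in K, this
   is lower semicontinuity of (x, t) |-> u x t on K `*` J. *)
Definition lsc_in_x n (K : set 'rV[R]_n) (J : set R) (u : 'rV[R]_n -> R -> R) :=
  forall x, K x -> forall e : R, 0 < e ->
    \forall y \near within K (nbhs x), forall t, J t -> u x t - e < u y t.

End function_spaces.

(* Main.v *)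
Require Import Defs.
From mathcomp Require Import all_boot all_order all_algebra.
From mathcomp Require Import all_classical all_reals all_analysis.
From mathcomp Require Import measurable_realfun ring lra.

Import Order.TTheory GRing.Theory Num.Theory.
Import numFieldNormedType.Exports.

Local Open Scope classical_set_scope.
Local Open Scope ring_scope.

(** The theorem is a maximum principle with an explicit barrier. Let [h] be the
    product of a height [delta], of the spatial cap [1 - |x - x0|^2 / r^2] cut
    off at [0], and of a ramp in time that starts from [0] at the initial time
    [t1] and equals [1] at [t0]. If [u x0 t0 < delta], then [u - h] takes a
    negative value in the cylinder. As [u] is nonnegative and [h] vanishes
    outside the ball and in the past, the negative part of [u - h] is lower
    semicontinuous on the closed cylinder, and [u - h] attains a negative minimum
    at some [(x, t)] with [x] in the ball and [t1 < t <= t2]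
    (lemma [negative_minimum]).

    At that point both operators are compared with those of [h]. In time every
    increment [u x t - u x tau] is at most that of [h], so the Marchaud
    derivative of [u] is at most a constant times [delta] ([marchaud_at_min]). In
    space [u x t - u y t] is at most the increment of [h], and on [D], where
    [u >= C0] and [h] vanishes, it is smaller by [C0] at least. Points of [D] are
    at bounded distance from [x], so the fractional Laplacian of [u] is at most
    [- Cns * C0 * interaction + constant * delta] ([frac_laplacian_at_min]), where
    [interaction] is the measure of [D] divided by a power of a distance that is
    computed from the diameter and the distance to [x0]. If [delta] and [eps] are
    small with respect to [Cns * C0 * interaction], this contradicts the
    supersolution inequality.

    Two analytic facts are behind these comparisons. The kernels
    [min (|z|^m, 1) / |z|^p] are integrable with a bound independent of the
    centre ([kernel_integral_le], by summation over dyadic shells). A term that is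
    linear in [y - x] does not contribute to a principal value, since Lebesgue
    measure is invariant under point reflections ([Rintegral_linear_part]); hence
    the limit that defines the fractional Laplacian of a [C^{1,1}] function exists
    ([principal_value_cvg]), and the cap, which is only bounded from one side by
    linear and quadratic terms, contributes a bounded amount
    ([principal_value_le]). *)

(** * The Euclidean norm *)

Section euclidean_norm.
Context {R : realType} {n : nat}.
Implicit Types (x y z : 'rV[R]_n).

Lemma enorm_ge0 x : 0 <= enorm x.
Proof. exact: sqrtr_ge0. Qed.

Lemma sqr_enorm x : enorm x ^+ 2 = \sum_i x ord0 i ^+ 2.
Proof. by rewrite sqr_sqrtr//; apply: sumr_ge0 => i _; exact: sqr_ge0. Qed.

Lemma enorm0 : enorm (0 : 'rV[R]_n) = 0.
Proof.
rewrite /enorm big1 ?sqrtr0// => i _; by rewrite mxE expr0n.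
Qed.

Lemma enormN x : enorm (- x) = enorm x.
Proof. by congr Num.sqrt; apply: eq_bigr => i _; rewrite mxE sqrrN. Qed.

Lemma enormBC x y : enorm (x - y) = enorm (y - x).
Proof. by rewrite -enormN opprB. Qed.

Lemma enormZ (a : R) x : enorm (a *: x) = `|a| * enorm x.
Proof.
rewrite /enorm -sqrtr_sqr -sqrtrM ?sqr_ge0//; congr Num.sqrt.
by rewrite mulr_sumr; apply: eq_bigr => i _; rewrite mxE exprMn.
Qed.

Lemma enorm_coord x i : `|x ord0 i| <= enorm x.
Proof.
rewrite -sqrtr_sqr ler_wsqrtr// (bigD1 i)//= lerDl.
by apply: sumr_ge0 => j _; exact: sqr_ge0.
Qed.

Lemma enorm_eq0 x : (enorm x == 0) = (x == 0).
Proof.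
apply/eqP/eqP => [x0|->]; last exact: enorm0.
apply/rowP => i; rewrite mxE; apply/eqP.
by rewrite -normr_le0 -x0 enorm_coord.
Qed.

(** With [a] and [b] the norms of [x] and [y], the inequality is the expansion
    of the nonnegative sums of squares of [a * y i - b * x i] and
    [a * y i + b * x i], divided by [2 * a * b]. *)
Lemma enorm_CS x y : `|\sum_i x ord0 i * y ord0 i| <= enorm x * enorm y.
Proof.
set c := \sum_i _; set a := enorm x; set b := enorm y.
have key e : (e = 1 \/ e = -1) -> 2 * a * b * (e * c) <= 2 * a ^+ 2 * b ^+ 2.
  move=> he.
  have : 0 <= \sum_i (a * y ord0 i - e * b * x ord0 i) ^+ 2.
    by apply: sumr_ge0 => i _; exact: sqr_ge0.
  have -> : \sum_i (a * y ord0 i - e * b * x ord0 i) ^+ 2 =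
      a ^+ 2 * (\sum_i y ord0 i ^+ 2) + e ^+ 2 * b ^+ 2 * (\sum_i x ord0 i ^+ 2)
        - 2 * a * b * (e * c).
    rewrite /c !mulr_sumr -sumrN -!big_split/=; apply: eq_bigr => i _; ring.
  rewrite -!sqr_enorm -/a -/b.
  by case: he => ->; lra.
have [a0|a0] := eqVneq a 0.
  have x0 : x = 0 by apply/eqP; rewrite -enorm_eq0 -/a a0.
  by rewrite /c x0 big1 ?normr0 ?a0 ?mul0r// => i _; rewrite mxE mul0r.
have [b0|b0] := eqVneq b 0.
  have x0 : y = 0 by apply/eqP; rewrite -enorm_eq0 -/b b0.
  by rewrite /c x0 big1 ?normr0 ?b0 ?mulr0// => i _; rewrite mxE mulr0.
have ab : 0 < 2 * a * b by rewrite !mulr_gt0// lt_neqAle eq_sym ?a0 ?b0 enorm_ge0.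
have k1 := key 1 (or_introl erefl); have k2 := key (-1) (or_intror erefl).
rewrite ler_norml; apply/andP; split.
  rewrite lerNl -(ler_pM2l ab) -mulN1r (le_trans k2)//.
  by rewrite le_eqVlt; apply/orP; left; apply/eqP; ring.
rewrite -(ler_pM2l ab) -[X in _ * X <= _]mul1r (le_trans k1)//.
by rewrite le_eqVlt; apply/orP; left; apply/eqP; ring.
Qed.

Lemma ler_enormD x y : enorm (x + y) <= enorm x + enorm y.
Proof.
rewrite -(@ler_pXn2r _ 2) ?nnegrE ?addr_ge0 ?enorm_ge0// sqr_enorm sqrrD !sqr_enorm.
have -> : \sum_i (x + y) ord0 i ^+ 2 = \sum_i x ord0 i ^+ 2 +
    (\sum_i x ord0 i * y ord0 i) *+ 2 + \sum_i y ord0 i ^+ 2.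
  rewrite -sumrMnl -!big_split/=; apply: eq_bigr => i _.
  by rewrite mxE sqrrD.
rewrite lerD2r lerD2l ler_wMn2r// (le_trans _ (enorm_CS x y))//.
exact: ler_norm.
Qed.

Lemma enorm_triangle x y z : enorm (x - z) <= enorm (x - y) + enorm (y - z).
Proof. by rewrite (le_trans _ (ler_enormD _ _))// addrA subrK. Qed.

Lemma le_norm_enorm x : `|x| <= enorm x.
Proof.
rewrite [leLHS]/Num.norm/= mx_normrE; apply/bigmax_leP; split; first exact: enorm_ge0.
by move=> -[i j] _ /=; rewrite ord1 enorm_coord.
Qed.

Lemma le_enorm_norm x : enorm x <= n%:R * `|x|.
Proof.
have nx : 0 <= `|x| by [].
rewrite -(@ler_pXn2r _ 2) ?nnegrE ?mulr_ge0 ?enorm_ge0// sqr_enorm.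
have h (i : 'I_n) : x ord0 i ^+ 2 <= `|x| ^+ 2.
  rewrite -(real_normK (num_real (x ord0 i))) ler_pXn2r ?nnegrE//.
  rewrite [leRHS]/Num.norm/= mx_normrE; apply/bigmax_geP; right => /=.
  by exists (ord0, i).
rewrite (le_trans (ler_sum _ (fun i _ => h i)))//.
rewrite sumr_const card_ord exprMn -[leLHS]mulr_natl ler_wpM2r ?sqr_ge0//.
case: n => [|m]; first by rewrite expr0n.
by rewrite -natrX ler_nat leq_pmulr.
Qed.

Lemma enorm_lipschitz x y : `|enorm x - enorm y| <= enorm (x - y).
Proof.
have := ler_enormD (y - x) x; have := ler_enormD (x - y) y.
by rewrite !subrK (enormBC y x) ler_norml => h1 h2; apply/andP; split; lra.
Qed.

Lemma continuous_enormB (c : 'rV[R]_n) : continuous (fun y => enorm (y - c)).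
Proof.
move=> x; apply/(@cvgrPdist_lt R R _ (nbhs x)) => e e0.
have h : 0 < e / n.+1%:R by rewrite divr_gt0.
apply/nbhs_ballP; exists (e / n.+1%:R) => //= y; rewrite -ball_normE /= => xy.
apply: le_lt_trans (enorm_lipschitz _ _) _; rewrite opprB addrA subrK.
apply: le_lt_trans (le_enorm_norm _) _.
rewrite (@le_lt_trans _ _ (n.+1%:R * `|x - y|))//.
  by rewrite ler_wpM2r// ler_nat.
by rewrite mulrC -ltr_pdivlMr.
Qed.

Lemma open_eball x (r : R) : open (eball x r).
Proof.
rewrite (_ : eball x r = (fun y => enorm (y - x)) @^-1` [set a | a < r])//.
by apply: open_comp => [y _|]; [exact: continuous_enormB|exact: open_lt].
Qed.

Lemma closed_eball_le x (r : R) : closed [set y | enorm (y - x) <= r].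
Proof.
rewrite (_ : mkset _ = (fun y => enorm (y - x)) @^-1` [set a | a <= r])//.
by apply: closed_comp => [y _|]; [exact: continuous_enormB|exact: closed_le].
Qed.

Lemma compact_eball_le x (r : R) : compact [set y | enorm (y - x) <= r].
Proof.
apply: bounded_closed_compact; last exact: closed_eball_le.
exists (r + enorm x); split; first exact: num_real.
move=> M rM y /= yr; rewrite (le_trans _ (ltW rM))// (le_trans (le_norm_enorm _))//.
by rewrite -{1}(subrK x y) (le_trans (ler_enormD _ _))// lerD2r.
Qed.

Lemma closure_eball_le x (r : R) : closure (eball x r) `<=` [set y | enorm (y - x) <= r].
Proof.
rewrite closureE; apply: smallest_sub; first exact: closed_eball_le.
by move=> y /= /ltW.
Qed.

Lemma compact_closure_eball x (r : R) : compact (closure (eball x r)).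
Proof.
apply: subclosed_compact (compact_eball_le x r) _; first exact: closed_closure.
exact: closure_eball_le.
Qed.

End euclidean_norm.

(** * Integrals of the truncated power kernel *)

Section kernel.
Context {R : realType}.
Local Notation h := (2^-1 : R)%R.

(** The sum of the two geometric series that bound the dyadic pieces of the
    kernel near the origin and at infinity. *)
Definition kernel_bound (C p : R) (N m : nat) : R :=
  C / h `^ p / (1 - h ^+ (m + N) / h `^ p) +
  C * 2 ^+ N / (1 - 2 ^+ N / 2 `^ p).

Lemma dyadic_bracket (x : R) : 1 <= x -> exists k : nat, 2 ^+ k <= x < 2 ^+ k.+1.
Proof.
move=> x1; have ex : exists j, x < 2 ^+ j.
  by exists (Num.bound x); apply: upper_nthrootP.
case: (ex_minnP ex) => -[|k] xk mink.
  by move: xk; rewrite expr0 ltNge x1.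
exists k; rewrite xk andbT leNgt; apply/negP => /mink; by rewrite ltnn.
Qed.

Lemma nneseries_geometric_le (a z : R) (u : nat -> \bar R) : 0 <= a -> 0 <= z < 1 ->
  (forall k, 0 <= u k <= (a * z ^+ k)%:E)%E ->
  (\sum_(0 <= k <oo) u k <= (a / (1 - z))%:E)%E.
Proof.
move=> a0 /andP[z0 z1] ub.
have u0 k : (0 <= u k)%E by have /andP[] := ub k.
apply: lime_le; first exact: is_cvg_nneseries.
apply: nearW => N.
apply: (@le_trans _ _ (\sum_(0 <= k < N) (a * z ^+ k)%:E)%E).
  by apply: lee_sum => k _; have /andP[] := ub k.
rewrite sumEFin lee_fin -mulr_sumr ler_wpM2l// -[leRHS]mul1r ler_pdivlMr ?subr_gt0//.
rewrite big_mkord mulrC -opprB mulNr -subrX1 opprB lerBlDr lerDl exprn_ge0//.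
Qed.

Lemma pow_ratio_lt1 (b p : R) (N : nat) : 1 < b -> N%:R < p -> 0 <= b ^+ N / b `^ p < 1.
Proof.
move=> b1 Np; have b0 : 0 < b by lra.
rewrite divr_ge0 ?powR_ge0 ?exprn_ge0 ?ltW//=.
rewrite ltr_pdivrMr ?powR_gt0// mul1r -powR_mulrn ?ltW//.
by rewrite /powR gt_eqF// ltr_expR ltr_pM2r// ln_gt0.
Qed.

Lemma half_pow_ratio_lt1 (p : R) (N : nat) : p < N%:R -> 0 <= h ^+ N / h `^ p < 1.
Proof.
move=> Np; have b0 : 0 < h by rewrite invr_gt0.
rewrite divr_ge0 ?powR_ge0 ?exprn_ge0 ?ltW//=.
rewrite ltr_pdivrMr ?powR_gt0// mul1r -powR_mulrn ?ltW//.
rewrite /powR gt_eqF// ltr_expR ltr_nM2r// ln_lt0//; lra.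
Qed.

Lemma kernel_bound_ge0 (C p : R) (N m : nat) :
  0 <= C -> N%:R < p -> p < (m + N)%:R -> 0 <= kernel_bound C p N m.
Proof.
move=> C0 Np pmN; have h0 : 0 < 2^-1 :> R by rewrite invr_gt0.
have /andP[_ z1] := half_pow_ratio_lt1 _ _ pmN.
have two1 : 1 < 2 :> R by rewrite ltr1n.
have /andP[_ z2] := pow_ratio_lt1 _ _ _ two1 Np.
by rewrite /kernel_bound addr_ge0// !divr_ge0 ?powR_ge0 ?mulr_ge0 ?exprn_ge0 ?subr_ge0 ?(ltW z1) ?(ltW z2).
Qed.

Lemma powR_exprn (x p : R) (k : nat) : 0 <= x -> (x ^+ k) `^ p = (x `^ p) ^+ k.
Proof.
by move=> x0; rewrite -[in LHS]powR_mulrn// powRAC powR_mulrn// powR_ge0.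
Qed.

Let near_piece (x b C : R) (k m N : nat) :
  x ^+ k ^+ m / (b ^+ k * b) * (C * x ^+ k ^+ N) = C / b * (x ^+ (m + N) / b) ^+ k.
Proof.
rewrite exprMn exprVn -!exprM mulnDl exprD invfM (mulnC m) (mulnC N); ring.
Qed.

Let far_piece (b C : R) (k N : nat) :
  (b ^+ k)^-1 * (C * (2 ^+ k.+1) ^+ N) = C * 2 ^+ N * (2 ^+ N / b) ^+ k.
Proof.
by rewrite exprS !exprMn exprVn -!exprM (mulnC k); ring.
Qed.

Context {d} {T : measurableType d} (mu : {measure set T -> \bar R}).
Variables (rho : T -> R) (C p : R) (N m : nat).
Hypotheses (mrho : measurable_fun setT rho) (rho0 : forall y, 0 <= rho y).
Hypotheses (C0 : 0 <= C) (Np : N%:R < p) (pmN : p < (m + N)%:R).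
Hypothesis growth : forall q, 0 < q -> (mu [set y | (rho y <= q)%R] <= (C * q ^+ N)%:E)%E.

Let ge0_integral_cst_indic (a : R) (B : set T) : 0 <= a -> measurable B ->
  (\int[mu]_y (a * \1_B y)%:E = a%:E * mu B)%E.
Proof.
move=> a0 mB; rewrite (@integralZl_indic _ _ _ _ _ measurableT (fun=> B))//; last first.
  by move=> a1; move: a0; rewrite leNgt a1.
by rewrite integral_indic// setIT.
Qed.

Let A q := [set y | rho y <= q].

Let mA q : measurable (A q).
Proof.
rewrite (_ : A q = setT `&` rho @^-1` `]-oo, q]%classic); first exact: mrho.
by rewrite setTI; apply/seteqP; split => y; rewrite /= in_itv.
Qed.

Let p0 : 0 < p.
Proof. by apply: le_lt_trans Np. Qed.

(** A dyadic shell contributes at most the supremum of the kernel on it times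
    the measure of a ball containing it. The shells near the zeros of [rho] give
    a geometric series that converges because [p < m + N], the distant ones
    because [N < p]. Only the growth of the measure enters, so that the bound
    serves both for time and for space. *)
Lemma kernel_integral_le :
  (\int[mu]_y (Num.min (rho y ^+ m) 1 / rho y `^ p)%:E <= (kernel_bound C p N m)%:E)%E.
Proof.
pose c k : R := (h ^+ k) ^+ m / (h ^+ k.+1) `^ p.
pose e k : R := ((2 ^+ k) `^ p)^-1.
have h0 : 0 < h by rewrite invr_gt0.
have c0 k : 0 <= c k by rewrite divr_ge0 ?powR_ge0 ?exprn_ge0// ltW.
have e0 k : 0 <= e k by rewrite invr_ge0 powR_ge0.
pose u k y : \bar R := (c k * \1_(A (h ^+ k)) y)%:E.
pose v k y : \bar R := (e k * \1_(A (2 ^+ k.+1)) y)%:E.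
have u0 k y : (0 <= u k y)%E by rewrite lee_fin mulr_ge0// indicE.
have v0 k y : (0 <= v k y)%E by rewrite lee_fin mulr_ge0// indicE.
have mu_ k : measurable_fun setT (u k).
  by apply/measurable_EFinP; apply: measurable_funM => //; exact: measurable_indic.
have mv_ k : measurable_fun setT (v k).
  by apply/measurable_EFinP; apply: measurable_funM => //; exact: measurable_indic.
have iu k : (\int[mu]_y u k y = (c k)%:E * mu (A (h ^+ k)%R))%E.
  exact: ge0_integral_cst_indic.
have iv k : (\int[mu]_y v k y = (e k)%:E * mu (A ((2 ^+ k.+1)%R)))%E.
  exact: ge0_integral_cst_indic.
apply: (@le_trans _ _ (\int[mu]_y (\sum_(0 <= k <oo) u k y + \sum_(0 <= k <oo) v k y))%E).
  apply: ge0_le_integral => //.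
  - by move=> y _; rewrite lee_fin divr_ge0 ?powR_ge0// le_min exprn_ge0/=.
  - apply/measurable_EFinP; apply: measurable_funM.
      by apply: measurable_minr => //; exact: measurable_funX.
    have -> : (fun y => (rho y `^ p)^-1) = (fun y => rho y `^ (- p)).
      by apply/funext => y; rewrite powRN.
    exact: measurableT_comp (measurable_powR _) mrho.
  - by apply: emeasurable_funD; apply: ge0_emeasurable_sum.
  move=> y _.
  have ser (w : nat -> T -> \bar R) k : (forall k y, 0 <= w k y)%E ->
      (w k y <= \sum_(0 <= k <oo) w k y)%E.
    move=> w0; apply: le_trans (nneseries_lim_ge k.+1 _) => //.
    by rewrite big_nat_recr//= leeDr// sume_ge0.
  have [->|y0] := eqVneq (rho y) 0.
    by rewrite powR0 ?gt_eqF// invr0 mulr0 adde_ge0//; apply: nneseries_ge0.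
  have y1 : 0 < rho y by rewrite lt_neqAle eq_sym y0 rho0.
  have [r1|r1] := lerP 1 (rho y).
    have [k /andP[k1 k2]] := dyadic_bracket _ r1.
    apply: (@le_trans _ _ (v k y)); last first.
      by apply: le_trans (ser v k v0) _; rewrite leeDr// nneseries_ge0.
    rewrite /v indicE mem_set; last exact: ltW.
    rewrite mulr1 lee_fin (@le_trans _ _ (1 / rho y `^ p))//.
      by rewrite ler_wpM2r ?invr_ge0 ?powR_ge0// ge_min lexx orbT.
    rewrite mul1r lef_pV2 ?posrE ?powR_gt0 ?exprn_gt0//.
    by rewrite ge0_ler_powR ?nnegrE ?exprn_ge0 ?(ltW p0).
  have r2 : 1 <= (rho y)^-1 by rewrite invf_ge1// ltW.
  have [k /andP[k1 k2]] := dyadic_bracket _ r2.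
  have k3 : rho y <= h ^+ k.
    by rewrite exprVn -[leLHS]invrK lef_pV2 ?posrE ?invr_gt0 ?exprn_gt0.
  have k4 : h ^+ k.+1 <= rho y.
    by rewrite exprVn -[leRHS]invrK lef_pV2 ?posrE ?invr_gt0 ?exprn_gt0// ltW.
  apply: (@le_trans _ _ (u k y)); last first.
    by apply: le_trans (ser u k u0) _; rewrite leeDl// nneseries_ge0.
  rewrite /u indicE mem_set// mulr1 lee_fin /c.
  apply: ler_pM; rewrite ?invr_ge0 ?powR_ge0 ?le_min ?exprn_ge0 ?ler01//.
    by rewrite ge_min lerXn2r ?nnegrE ?exprn_ge0 ?(ltW h0).
  rewrite lef_pV2 ?posrE ?powR_gt0 ?exprn_gt0//.
  by rewrite ge0_ler_powR ?nnegrE ?exprn_ge0 ?(ltW p0)// ltW.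
rewrite ge0_integralD//; last 4 first.
- by move=> y _; apply: nneseries_ge0.
- by apply: ge0_emeasurable_sum.
- by move=> y _; apply: nneseries_ge0.
- by apply: ge0_emeasurable_sum.
rewrite !integral_nneseries// /kernel_bound EFinD leeD//.
  apply: nneseries_geometric_le; first by rewrite divr_ge0 ?powR_ge0.
    exact: half_pow_ratio_lt1.
  move=> k; rewrite integral_ge0/= ?iu; last by move=> *; exact: u0.
  apply: le_trans (lee_wpmul2l _ (growth _ _)) _; rewrite ?lee_fin ?exprn_gt0 ?c0 ?e0 //.
  rewrite /c exprSr powRM ?exprn_ge0 ?(ltW h0)//.
  have -> : (h ^+ k) `^ p = (h `^ p) ^+ k.
    exact/powR_exprn/ltW.
  by rewrite near_piece.
apply: nneseries_geometric_le; first by rewrite mulr_ge0.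
  by apply: pow_ratio_lt1 => //; lra.
move=> k; rewrite integral_ge0/= ?iv; last by move=> *; exact: v0.
apply: le_trans (lee_wpmul2l _ (growth _ _)) _; rewrite ?lee_fin ?exprn_gt0 ?c0 ?e0 //.
rewrite /e.
have -> : (2 ^+ k : R) `^ p = (2 `^ p) ^+ k.
  exact: powR_exprn.
by rewrite far_piece.
Qed.

End kernel.

(** * Lebesgue measure on row vectors *)

Section lebesgue_rV_facts.
Context {R : realType}.

Lemma measurable_enormB {n} (x : 'rV[R]_n) :
  measurable_fun setT (fun y : 'rV[R]_n => enorm (y - x)).
Proof.
apply: (@measurableT_comp _ _ _ _ _ _ (@Num.sqrt R)).
  by apply: continuous_measurable_fun; exact: sqrt_continuous.
apply: measurable_sum => i; apply: measurable_funX.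
under eq_fun do rewrite !mxE.
apply: measurable_funB => //; exact: measurable_rV_coord.
Qed.

Lemma measurable_eball {n} (x : 'rV[R]_n) (r : R) : measurable (eball x r).
Proof.
rewrite (_ : eball x r = setT `&` (fun y => enorm (y - x)) @^-1` `]-oo, r[%classic).
  exact: measurable_enormB.
by rewrite setTI; apply/seteqP; split => y; rewrite /= in_itv.
Qed.

Lemma measurable_eball_le {n} (x : 'rV[R]_n) (r : R) :
  measurable [set y : 'rV[R]_n | enorm (y - x) <= r].
Proof.
rewrite (_ : mkset _ = setT `&` (fun y => enorm (y - x)) @^-1` `]-oo, r]%classic).
  exact: measurable_enormB.
by rewrite setTI; apply/seteqP; split => y; rewrite /= in_itv.
Qed.

Definition box {n} (x : 'rV[R]_n) (e : R) : set 'rV[R]_n :=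
  [set y | forall i, (x - const_mx e) ord0 i <= y ord0 i <= (x + const_mx e) ord0 i].

Lemma boxP {n} (x y : 'rV[R]_n) e : box x e y <-> forall i, `|y ord0 i - x ord0 i| <= e.
Proof.
by split => h i; have := h i; rewrite !mxE ler_distl.
Qed.

Lemma lebesgue_rV_cube {n} (x : 'rV[R]_n) (e : R) : 0 <= e ->
  lebesgue_rV (box x e) = ((2 * e) ^+ n)%:E.
Proof.
move=> e0; rewrite [LHS]lebesgue_rV_box; last first.
  by move=> i; rewrite !mxE; lra.
congr EFin; rewrite (eq_bigr (fun=> 2 * e)) ?prodr_const ?card_ord// => i _.
by rewrite !mxE; ring.
Qed.

Lemma lebesgue_rV_eball_le {n} (x : 'rV[R]_n) (q : R) : 0 < q ->
  (lebesgue_rV [set y : 'rV[R]_n | (enorm (y - x) <= q)%R] <= (2 ^+ n * q ^+ n)%:E)%E.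
Proof.
move=> q0; rewrite -exprMn -(lebesgue_rV_cube x q (ltW q0)).
apply: le_measure; rewrite ?inE.
- exact: measurable_eball_le.
- exact: measurable_rV_box.
move=> y /= yq; apply/boxP => i; apply: le_trans yq.
by rewrite (le_trans _ (enorm_coord _ i))// !mxE.
Qed.

Lemma open_contains_box {n} (D : set 'rV[R]_n) x : open D -> D x ->
  exists2 e, 0 < e & box x e `<=` D.
Proof.
move=> oD Dx; have /nbhs_ballP[e /= e0 eD] : nbhs x D by exact: open_nbhs_nbhs.
exists (e / 2); first by rewrite divr_gt0.
move=> y /boxP xy; apply: eD; rewrite -ball_normE /=.
rewrite (@le_lt_trans _ _ (e / 2))//; last by rewrite ltr_pdivrMr// ltr_pMr// ltr1n.
rewrite [leLHS]/Num.norm/= mx_normrE; apply/bigmax_leP; split; first by rewrite divr_ge0// ltW.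
by move=> -[i j] _ /=; rewrite ord1 !mxE distrC.
Qed.

(** Rational cubes form a countable base of the topology. *)
Lemma open_measurable_rV {n} (D : set 'rV[R]_n) : open D -> measurable D.
Proof.
move=> oD.
pose F (k : nat) : set 'rV[R]_n :=
  if @unpickle ('rV[rat]_n * nat)%type k is Some (q, j) then
    let b := box (map_mx ratr q) j.+1%:R^-1 in if `[< b `<=` D >] then b else set0
  else set0.
have -> : D = \bigcup_k F k.
  apply/seteqP; split => [x Dx|x [k _]]; last first.
    rewrite /F; case: unpickle => // -[q j] /=.
    by case: asboolP => // h /h.
  have [e e0 eD] := open_contains_box _ _ oD Dx.
  have [j je] : exists j : nat, j.+1%:R^-1 < e / 2.
    have e2 : 0 < e / 2 by rewrite divr_gt0.
    exists (Num.trunc (e / 2)^-1).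
    rewrite invf_plt ?posrE// ?invr_gt0//.
    exact: truncnS_gt.
  have [q qx] : exists q : 'rV[rat]_n, forall i,
      `|x ord0 i - (map_mx ratr q : 'rV[R]_n) ord0 i| <= j.+1%:R^-1.
    have /choice[f fx] : forall i : 'I_n, exists q : rat, `|x ord0 i - ratr q| <= j.+1%:R^-1.
      move=> i; have : x ord0 i - j.+1%:R^-1 < x ord0 i + j.+1%:R^-1.
        by rewrite ltrBlDr -addrA ltrDl addr_gt0// invr_gt0.
      move/rat_in_itvoo => [q]; rewrite in_itv/= => /andP[q1 q2].
      by exists q; rewrite ler_distlC (ltW q1) (ltW q2).
    by exists (\row_i f i) => i; rewrite !mxE.
  exists (pickle (q, j)) => //; rewrite /F pickleK /=.
  case: asboolP => [_|]; first exact/boxP.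
  case; move=> y /boxP yq; apply: eD; apply/boxP => i.
  move: (qx i) (yq i) je; move: (j.+1%:R^-1) => d.
  rewrite !ler_norml => /andP[a1 a2] /andP[b1 b2] de.
  by apply/andP; split; lra.
apply: bigcupT_measurable => k; rewrite /F; case: unpickle => [[q j]|//] /=.
by case: asboolP => // _; exact: measurable_rV_box.
Qed.

Lemma lebesgue_rV_open_gt0 {n} (D : set 'rV[R]_n) : open D -> D !=set0 ->
  (0 < lebesgue_rV D)%E.
Proof.
move=> oD [x Dx]; have [e e0 eD] := open_contains_box _ _ oD Dx.
apply: (@lt_le_trans _ _ (lebesgue_rV (box x e))).
  by rewrite lebesgue_rV_cube ?ltW// lte_fin exprn_gt0// mulr_gt0.
apply: le_measure; rewrite ?inE//; first exact: measurable_rV_box.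
exact: open_measurable_rV.
Qed.

Lemma measurable_subl (a : R) : measurable_fun setT (fun t : measurableTypeR R => a - t : measurableTypeR R).
Proof. exact: measurable_funB. Qed.

Lemma lebesgue_measure_reflect (a : R) (A : set R) : measurable A ->
  pushforward lebesgue_measure (fun t => a - t : measurableTypeR R) A = lebesgue_measure A.
Proof.
move=> mA; apply/esym.
apply: (@lebesgue_measure_unique R
  (@measure_function_pushforward__canonical__measure_function_Measure
   _ _ _ _ R lebesgue_measure _ (measurable_subl a))) => //= _ [[c b]] _ <-.
rewrite /pushforward (_ : _ @^-1` _ = `[a - b, a - c[%classic); last first.
  apply/seteqP; split=> t; rewrite /= !in_itv/= => /andP[h1 h2]; apply/andP; split; lra.
rewrite !lebesgue_measure_itv/= !lte_fin ltrD2l ltrN2.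
by congr (if _ then _ else _); rewrite -!EFinD; congr EFin; ring.
Qed.

(** The slice of the reflected set over [t] is the reflection of the slice over
    [c 0 - t], so that invariance propagates along the iterated products. *)
Lemma lebesgue_rV_reflect n (c : 'rV[R]_n) (A : set 'rV[R]_n) : measurable A ->
  pushforward (@lebesgue_rV R n) (fun y => c - y) A = lebesgue_rV A.
Proof.
elim: n c A => [|n IH] c A mA.
  rewrite /pushforward (_ : _ @^-1` A = A)//.
  by apply/seteqP; split => y /=; rewrite (_ : c - y = y)// !thinmx0.
pose tl : 'rV[R]_n := \row_i c ord0 (rshift 1 i : 'I_n.+1).
have cE t y : c - rV_cons (t, y) = rV_cons (c ord0 ord0 - t, tl - y).
  apply/rowP => i; case: (@split_ordP 1 n i) => j ->.
    have -> : lshift n j = ord0 by apply/val_inj; rewrite /= ord1.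
    have e := @rV_coord_cons0 R n; rewrite /rV_coord in e.
    by rewrite mxE e mxE e.
  have e := @rV_coord_consS R n; rewrite /rV_coord in e.
  by rewrite mxE e mxE e !mxE.
set B := @rV_cons R n @^-1` A.
have mB : measurable B.
  by rewrite -[B]setTI; apply: measurable_rV_cons.
have BE t : xsection (@rV_cons R n @^-1` ((fun y => c - y) @^-1` A)) t =
    (fun y => tl - y) @^-1` xsection B (c ord0 ord0 - t).
  apply/seteqP; split => y; rewrite /xsection /= !inE /B /= cE//.
rewrite /pushforward /= /pushforward /product_measure1.
under eq_integral => t _ do rewrite /= BE.
transitivity (\int[lebesgue_measure]_t
    (@lebesgue_rV R n \o xsection B) (c ord0 ord0 - t)%R)%E.
  apply: eq_integral => t _ /=; apply: IH; exact: measurable_xsection.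
have mF : measurable_fun setT (@lebesgue_rV R n \o xsection B).
  exact: measurable_fun_xsection.
transitivity (\int[pushforward lebesgue_measure
    (fun t => (c ord0 ord0 - t)%R : measurableTypeR R)]_t
    (@lebesgue_rV R n \o xsection B) t)%E.
  by rewrite (ge0_integral_pushforward (measurable_subl _)).
apply: (@eq_measure_integral _ _ _ _ lebesgue_measure) => [|? S mS _]; first exact: measurable_subl.
exact: lebesgue_measure_reflect.
Qed.

Lemma measurable_rV_subl {n} (c : 'rV[R]_n) : measurable_fun setT (fun y : 'rV[R]_n => c - y : 'rV[R]_n).
Proof.
apply: measurable_fun_rV => i.
rewrite (_ : _ \o _ = fun y => c ord0 i - rV_coord i y); last first.
  by apply/funext => y; rewrite /rV_coord/= !mxE.
by apply: measurable_funB => //; exact: measurable_rV_coord.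
Qed.

Lemma ge0_integral_reflect {n} (c : 'rV[R]_n) (f : 'rV[R]_n -> \bar R) :
  measurable_fun setT f -> (forall y, 0 <= f y)%E ->
  (\int[@lebesgue_rV R n]_y f (c - y)%R = \int[@lebesgue_rV R n]_y f y)%E.
Proof.
move=> mf f0.
transitivity (\int[pushforward (@lebesgue_rV R n) (fun y => (c - y)%R)]_y f y)%E.
  by rewrite (ge0_integral_pushforward (measurable_rV_subl c)).
apply: (@eq_measure_integral _ _ _ _ (@lebesgue_rV R n)) => [|? S mS _].
  exact: measurable_rV_subl.
exact: lebesgue_rV_reflect.
Qed.

(** By reflection the positive and the negative parts of the integrand have the
    same integral. *)
Lemma integral_odd {n} (x : 'rV[R]_n) (f : 'rV[R]_n -> R) :
  measurable_fun setT f -> (forall y, f (x + x - y) = - f y) ->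
  (@lebesgue_rV R n).-integrable setT (EFin \o f) ->
  \int[@lebesgue_rV R n]_y f y = 0.
Proof.
move=> mf oddf intf; rewrite /Rintegral.
suff -> : (\int[@lebesgue_rV R n]_y (f y)%:E = 0)%E by [].
rewrite integralE.
have -> : (\int[@lebesgue_rV R n]_y (fun y => (f y)%:E)^\- y =
           \int[@lebesgue_rV R n]_y (fun y => (f y)%:E)^\+ y)%E.
  rewrite -(ge0_integral_reflect (x + x)) => //; last first.
    by apply: measurable_funeneg; exact/measurable_EFinP.
  apply: eq_integral => y _; rewrite funenegE funeposE oddf.
  by rewrite EFinN oppeK.
rewrite subee//; exact: integrable_pos_fin_num.
Qed.

End lebesgue_rV_facts.

(** * Principal values *)

Section real_integrable.
Context {d} {T : measurableType d} {R : realType} (mu : {measure set T -> \bar R}).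
Implicit Types (D : set T) (f g : T -> R).

Lemma integrableDR D f g : measurable D ->
  mu.-integrable D (EFin \o f) -> mu.-integrable D (EFin \o g) ->
  mu.-integrable D (EFin \o (fun y => f y + g y)).
Proof. by move=> mD fi gi; exact: (integrableD mD fi gi). Qed.

Lemma integrableZR D (k : R) f : measurable D ->
  mu.-integrable D (EFin \o f) -> mu.-integrable D (EFin \o (fun y => k * f y)).
Proof. by move=> mD fi; exact: (integrableZl mD k fi). Qed.

Lemma le_integrableR D f g : measurable D -> measurable_fun D f ->
  (forall y, D y -> `|f y| <= g y) -> mu.-integrable D (EFin \o g) ->
  mu.-integrable D (EFin \o f).
Proof.
move=> mD mf fg; apply: le_integrable => //; first exact/measurable_EFinP.
by move=> y Dy; rewrite /= lee_fin (le_trans (fg _ Dy))// ler_norm.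
Qed.

Lemma eq_Rintegral_mod0 D f g h : measurable D ->
  (forall y, D y -> f y = g y - h y) ->
  mu.-integrable D (EFin \o g) -> mu.-integrable D (EFin \o h) ->
  \int[mu]_(y in D) h y = 0 -> \int[mu]_(y in D) f y = \int[mu]_(y in D) g y.
Proof.
move=> mD fE ig ih h0; rewrite -[RHS]subr0 -h0 -RintegralB//.
by apply: eq_Rintegral => y /set_mem; exact: fE.
Qed.

Lemma le_Rintegral_comb D f g1 g2 h (a b : R) : measurable D ->
  mu.-integrable D (EFin \o f) -> mu.-integrable D (EFin \o g1) ->
  mu.-integrable D (EFin \o g2) -> mu.-integrable D (EFin \o h) ->
  (forall y, D y -> f y <= a * g1 y + h y + b * g2 y) ->
  \int[mu]_(y in D) h y = 0 ->
  \int[mu]_(y in D) f y <= a * \int[mu]_(y in D) g1 y + b * \int[mu]_(y in D) g2 y.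
Proof.
move=> mD fi gi1 gi2 hi fle h0.
have ai := integrableZR D a g1 mD gi1; have bi := integrableZR D b g2 mD gi2.
have ahi := integrableDR D _ _ mD ai hi.
apply: le_trans (le_Rintegral mD fi (integrableDR D _ _ mD ahi bi) fle) _.
by rewrite RintegralD// RintegralD// RintegralZl// RintegralZl// h0 addr0.
Qed.

End real_integrable.

Section principal_value.
Context {R : realType} {n : nat} (s : R).
Hypothesis hs : 0 < s < 1.
Local Notation nu := (@lebesgue_rV R n).
Local Notation p := (n%:R + 2 * s).
Local Notation tail := (fun v : 'rV[R]_n -> R => fun y => `|v y| / (1 + enorm y `^ p)).

Let np : n%:R < p. Proof. by move: hs => /andP[? ?]; lra. Qed.
Let pn : p < (2 + n)%:R. Proof. by rewrite natrD; move: hs => /andP[? ?]; lra. Qed.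
Let p0 : 0 < p. Proof. by apply: le_lt_trans np. Qed.
Let pN0 : p != 0. Proof. by rewrite gt_eqF. Qed.

Definition kernel (x y : 'rV[R]_n) : R :=
  Num.min (enorm (y - x) ^+ 2) 1 / enorm (y - x) `^ p.

Lemma measurable_enorm_powR (x : 'rV[R]_n) :
  measurable_fun setT (fun y : 'rV[R]_n => (enorm (y - x) `^ p)^-1).
Proof.
have -> : (fun y : 'rV[R]_n => (enorm (y - x) `^ p)^-1) = (fun y => enorm (y - x) `^ (- p)).
  by apply/funext => y; rewrite powRN.
exact: (measurableT_comp (measurable_powR _) (measurable_enormB x)).
Qed.

Lemma measurable_kernel x : measurable_fun setT (kernel x).
Proof.
apply: measurable_funM; last exact: measurable_enorm_powR.
apply: measurable_minr => //; apply: measurable_funX; exact: measurable_enormB.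
Qed.

Lemma kernel_ge0 x y : 0 <= kernel x y.
Proof. by rewrite divr_ge0 ?powR_ge0// le_min sqr_ge0 ler01. Qed.

Definition kernel_mass : R := kernel_bound (2 ^+ n) p n 2.

Lemma integral_kernel_le x : (\int[nu]_y (kernel x y)%:E <= kernel_mass%:E)%E.
Proof.
apply: (@kernel_integral_le R _ _ (@lebesgue_rV R n)) => //.
- exact: measurable_enormB.
- by move=> y; exact: enorm_ge0.
- by move=> q q0; exact: lebesgue_rV_eball_le.
Qed.

Lemma integrable_kernel x : nu.-integrable setT (EFin \o kernel x).
Proof.
apply/integrableP; split; first by apply/measurable_EFinP; exact: measurable_kernel.
apply: (@le_lt_trans _ _ kernel_mass%:E); last exact: ltry.
apply: (le_trans _ (integral_kernel_le x)).
rewrite (eq_integral (fun y => (kernel x y)%:E))// => y _ /=.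
by rewrite ger0_norm ?kernel_ge0.
Qed.

Lemma integrable_tail v : L_2s s v -> nu.-integrable setT (EFin \o tail v).
Proof.
move=> [[mv _] tv]; apply/integrableP; split.
  apply/measurable_EFinP; apply: measurable_funM.
    exact: measurableT_comp.
  have -> : (fun y : 'rV[R]_n => (1 + enorm y `^ p)^-1) =
      (fun y => (1 + enorm (y - 0) `^ p) `^ (-1)).
    by apply/funext => y; rewrite subr0 powR_inv1// addr_ge0// powR_ge0.
  apply: (measurableT_comp (measurable_powR _)); apply: measurable_funD => //.
  exact: (measurableT_comp (measurable_powR _) (measurable_enormB 0)).
apply: le_lt_trans tv; rewrite (eq_integral (fun y => (tail v y)%:E))// => y _ /=.
by rewrite ger0_norm// divr_ge0// addr_ge0// powR_ge0.
Qed.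

(** Away from [x] the singular kernel is comparable both with the truncated one,
    which controls the constant [v x], and with the weight that defines the
    function space, which controls [v y]. *)
Lemma far_bound v x e y : 0 < e -> e <= enorm (y - x) ->
  `|v x - v y| / enorm (x - y) `^ p <=
  `|v x| * (1 + (e ^+ 2)^-1) * kernel x y +
  ((e^-1) `^ p + (enorm x / e + 1) `^ p) * tail v y.
Proof.
move=> e0 ey; rewrite (enormBC x y) /kernel.
have z0 : 0 < enorm (y - x) by exact: lt_le_trans ey.
set z := enorm (y - x) in ey z0 *.
have Z0 : 0 < z `^ p by rewrite powR_gt0.
apply: (@le_trans _ _ (`|v x| / z `^ p + `|v y| / z `^ p)).
  by rewrite -mulrDl ler_wpM2r ?invr_ge0 ?powR_ge0// ler_normB.
apply: lerD.
  rewrite mulrA ler_wpM2r ?invr_ge0 ?powR_ge0// -mulrA -[leLHS]mulr1.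
  rewrite ler_wpM2l// /Num.min; case: ifPn => _; last first.
    by rewrite mulr1 lerDl invr_ge0 sqr_ge0.
  have e2 : 0 < e ^+ 2 by rewrite exprn_gt0.
  have ez : e ^+ 2 <= z ^+ 2 by rewrite lerXn2r ?nnegrE ?(ltW e0) ?(ltW z0).
  rewrite mulrDl mul1r (@le_trans _ _ ((e ^+ 2)^-1 * z ^+ 2))//.
    by rewrite mulrC ler_pdivlMr// mul1r.
  by rewrite lerDr sqr_ge0.
rewrite mulrCA ler_wpM2l//.
have D0 : 0 < 1 + enorm y `^ p by rewrite ltr_pwDl// powR_ge0.
rewrite ler_pdivlMr// ler_pdivrMl// mulrDr lerD//.
  rewrite -powRM ?invr_ge0 ?(ltW e0) ?(ltW z0)//.
  apply: (@le_trans _ _ (1 `^ p)); first by rewrite powR1.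
  have ze : 1 <= z / e by rewrite ler_pdivlMr ?mul1r.
  by apply: ge0_ler_powR; rewrite ?nnegrE ?(le_trans ler01 ze) ?(ltW p0).
have xe : 0 <= enorm x / e by rewrite divr_ge0 ?enorm_ge0 ?ltW.
rewrite -powRM ?addr_ge0 ?(ltW z0)//.
apply: ge0_ler_powR; rewrite ?nnegrE ?(ltW p0) ?mulr_ge0 ?addr_ge0 ?enorm_ge0 ?(ltW z0)//.
rewrite -{1}(subrK x y) (le_trans (ler_enormD _ _))// mulrDr mulr1 addrC lerD2r.
by rewrite mulrC mulrAC ler_pdivlMr// ler_wpM2l ?enorm_ge0.
Qed.


Section pieces.
Variable x : 'rV[R]_n.
Local Notation E e := (~` eball x e).

Lemma measurable_far e : measurable (E e).
Proof. by apply: measurableC; exact: measurable_eball. Qed.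

Lemma farE e y : E e y = (e <= enorm (y - x)) :> Prop.
Proof. by apply/propext; rewrite /eball /= leNgt; split => /negP. Qed.

(** The cut-off at radius [rho] makes the linear term integrable at infinity
    against the kernel without spoiling its oddness about [x]. *)
Definition linear_part (a : 'rV[R]_n) (rho : R) (y : 'rV[R]_n) : R :=
  \1_(eball x rho) y * (\sum_i a ord0 i * (y - x) ord0 i).

Lemma measurable_linear_part a rho : measurable_fun setT (linear_part a rho).
Proof.
apply: measurable_funM; first by apply: measurable_indic; exact: measurable_eball.
apply: measurable_sum => i; apply: measurable_funM => //.
under eq_fun do rewrite !mxE.
by apply: measurable_funB => //; exact: measurable_rV_coord.
Qed.

Lemma norm_linear_part_le a rho e y : 0 < e -> 0 < rho -> e <= enorm (y - x) ->
  `|linear_part a rho y / enorm (y - x) `^ p| <=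
  enorm a * (e^-1 + rho) * kernel x y.
Proof.
move=> e0 r0 ey; have z0 : 0 < enorm (y - x) by exact: lt_le_trans ey.
rewrite /kernel mulrA normrM [X in _ * X <= _]ger0_norm ?invr_ge0 ?powR_ge0//.
rewrite ler_wpM2r ?invr_ge0 ?powR_ge0// /linear_part indicE.
have A0 : 0 <= enorm a * (e^-1 + rho) by rewrite mulr_ge0 ?enorm_ge0 ?addr_ge0 ?invr_ge0 ?ltW.
have [yr|yr] := boolP (y \in eball x rho); last first.
  by rewrite mul0r normr0 mulr_ge0// le_min sqr_ge0 ler01.
rewrite mul1r (le_trans (enorm_CS _ _))// -mulrA ler_wpM2l ?enorm_ge0//.
move: yr; rewrite inE /eball /= => yr.
rewrite /Num.min; case: ifPn => _; rewrite mulrDl.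
  rewrite (@le_trans _ _ (e^-1 * enorm (y - x) ^+ 2))//; last first.
    by rewrite lerDl mulr_ge0 ?sqr_ge0 ?ltW.
  by rewrite mulrC ler_pdivlMr// expr2 ler_wpM2l ?enorm_ge0.
by rewrite !mulr1 (le_trans (ltW yr))// lerDr invr_ge0 ltW.
Qed.

Lemma integrable_linear_part a rho e : 0 < e -> 0 < rho ->
  nu.-integrable (E e) (EFin \o (fun y => linear_part a rho y / enorm (y - x) `^ p)).
Proof.
move=> e0 r0.
apply: (@le_integrableR _ _ _ _ _ _ (fun y => enorm a * (e^-1 + rho) * kernel x y)).
- exact: measurable_far.
- apply: measurable_funTS; apply: measurable_funM; first exact: measurable_linear_part.
  exact: measurable_enorm_powR.
- by move=> y; rewrite farE => ey; exact: norm_linear_part_le.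
- apply: integrableZR; first exact: measurable_far.
  by apply: integrableS (integrable_kernel x) => //; exact: measurable_far.
Qed.

(** The linear part of the increment is odd about [x] and the annulus is
    symmetric, which is why the principal value only sees second order terms. *)
Lemma Rintegral_linear_part a rho e : 0 < e -> 0 < rho ->
  \int[nu]_(y in E e) (linear_part a rho y / enorm (y - x) `^ p) = 0.
Proof.
move=> e0 r0; rewrite Rintegral_mkcond.
have restrE y : ((fun y => linear_part a rho y / enorm (y - x) `^ p) \_ (E e)) y =
    \1_(E e) y * (linear_part a rho y / enorm (y - x) `^ p).
  by rewrite patchE indicE; case: ifP => _; rewrite ?mul1r ?mul0r.
apply: (@integral_odd R n x).
- rewrite (funext restrE); apply: measurable_funM.
    by apply: measurable_indic; exact: measurable_far.
  apply: measurable_funM; first exact: measurable_linear_part.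
  exact: measurable_enorm_powR.
- move=> y; rewrite !restrE /linear_part.
  have yx : x + x - y - x = - (y - x) by rewrite opprB addrAC addrK.
  rewrite yx enormN.
  have -> : \1_(E e) (x + x - y) = \1_(E e) y :> R.
    rewrite !indicE; congr (nat_of_bool _)%:R; apply: asbool_equiv_eq.
    by rewrite !farE yx enormN.
  have -> : \1_(eball x rho) (x + x - y) = \1_(eball x rho) y :> R.
    rewrite !indicE; congr (nat_of_bool _)%:R; apply: asbool_equiv_eq.
    by rewrite /eball /= yx enormN.
  have -> : \sum_i a ord0 i * (- (y - x)) ord0 i = - \sum_i a ord0 i * (y - x) ord0 i.
    by rewrite -sumrN; apply: eq_bigr => i _; rewrite !mxE mulrN.
  by rewrite mulrN mulNr mulrN.
- have := @integrable_mkcond _ _ _ nu _ (EFin \o (fun y => linear_part a rho y / enorm (y - x) `^ p))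
      (measurable_far e).
  by rewrite restrict_EFin => <-; exact: integrable_linear_part.
Qed.

Lemma integrable_far v e : L_2s s v -> 0 < e ->
  nu.-integrable (E e) (EFin \o (fun y => (v x - v y) / enorm (x - y) `^ p)).
Proof.
move=> Lv e0; have [[mv _] _] := Lv.
apply: (@le_integrableR _ _ _ _ _ _ (fun y =>
  `|v x| * (1 + (e ^+ 2)^-1) * kernel x y +
  ((e^-1) `^ p + (enorm x / e + 1) `^ p) * tail v y)).
- exact: measurable_far.
- apply: measurable_funTS; apply: measurable_funM; first exact: measurable_funB.
  under eq_fun do rewrite enormBC; exact: measurable_enorm_powR.
- move=> y; rewrite farE => ey; rewrite normrM [X in _ * X <= _]ger0_norm ?invr_ge0 ?powR_ge0//.
  exact: far_bound.
- have mE := measurable_far e.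
  apply: integrableDR => //; apply: integrableZR => //.
    by apply: integrableS (integrable_kernel x).
  by apply: integrableS (integrable_tail v Lv).
Qed.

End pieces.


(** Subtracting the odd linear part leaves an integrand dominated, uniformly in
    the radius, by the truncated kernel plus the tail weight. *)
Lemma principal_value_cvg (v : 'rV[R]_n -> R) (x a : 'rV[R]_n) (C rho : R) :
  L_2s s v -> 0 < rho -> 0 <= C ->
  (forall y, enorm (y - x) < rho ->
    `|v y - v x - \sum_i a ord0 i * (y - x) ord0 i| <= C * enorm (y - x) ^+ 2) ->
  cvg ((\int[nu]_(y in ~` eball x e) ((v x - v y) / enorm (x - y) `^ p)) @[e --> 0^'+]).
Proof.
move=> Lv r0 C0 tay; have [[mv _] _] := Lv.
pose q y := (v x - v y + linear_part x a rho y) / enorm (x - y) `^ p.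
pose g y := C * (1 + rho ^+ 2) * kernel x y +
  (`|v x| * (1 + (rho ^+ 2)^-1) * kernel x y +
  ((rho^-1) `^ p + (enorm x / rho + 1) `^ p) * tail v y).
have ig : nu.-integrable setT (EFin \o g).
  apply: integrableDR => //.
    by apply: integrableZR => //; exact: integrable_kernel.
  apply: integrableDR => //; apply: integrableZR => //; first exact: integrable_kernel.
  exact: integrable_tail.
have mq : measurable_fun setT q.
  apply: measurable_funM; last first.
    by under eq_fun do rewrite enormBC; exact: measurable_enorm_powR.
  by apply: measurable_funD; [exact: measurable_funB|exact: measurable_linear_part].
have tail0 y : 0 <= tail v y by rewrite divr_ge0// addr_ge0// powR_ge0.
have qg y : `|q y| <= g y.
  rewrite /q normrM [X in _ * X <= _]ger0_norm ?invr_ge0 ?powR_ge0//.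
  have [yr|ry] := ltP (enorm (y - x)) rho; last first.
    rewrite /linear_part indicE memNset ?mul0r ?addr0; last first.
      by rewrite /eball /=; apply/negP; rewrite -leNgt.
    apply: le_trans (far_bound v x rho y r0 ry) _.
    by rewrite lerDr (mulr_ge0 _ (kernel_ge0 x y))// mulr_ge0// addr_ge0// sqr_ge0.
  rewrite /linear_part indicE mem_set// mul1r.
  rewrite (@le_trans _ _ (C * (1 + rho ^+ 2) * kernel x y))//; last first.
    rewrite lerDl addr_ge0// mulr_ge0 ?kernel_ge0 ?addr_ge0 ?powR_ge0//.
    by rewrite mulr_ge0// addr_ge0// invr_ge0 sqr_ge0.
  rewrite /kernel mulrA (enormBC x y) ler_wpM2r ?invr_ge0 ?powR_ge0//.
  rewrite -normrN opprD opprB (le_trans (tay y yr))// -mulrA ler_wpM2l//.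
  rewrite /Num.min; case: ifPn => _; rewrite mulrDl mul1r.
    by rewrite lerDl mulr_ge0// sqr_ge0.
  rewrite mulr1 (@le_trans _ _ (rho ^+ 2))// ?lerDr//.
  by rewrite lerXn2r ?nnegrE ?enorm_ge0 ?(ltW r0) ?(ltW yr).
have iq : nu.-integrable setT (EFin \o q).
  exact: (@le_integrableR _ _ _ _ _ _ g).
have split_q e : 0 < e ->
    \int[nu]_(y in ~` eball x e) ((v x - v y) / enorm (x - y) `^ p) =
    \int[nu]_(y in ~` eball x e) q y.
  move=> e0; have mE := measurable_far x e.
  apply: (eq_Rintegral_mod0 _ _ _ _ (fun y => linear_part x a rho y / enorm (y - x) `^ p)).
  - exact: mE.
  - by move=> y _; rewrite /q (enormBC x y) -mulrBl; congr (_ / _); ring.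
  - by apply: integrableS iq.
  - exact: integrable_linear_part.
  - exact: Rintegral_linear_part.
apply/cvg_ex; exists (\int[nu]_y q y); apply/cvg_at_rightP => u [u0 ucvg].
rewrite (_ : (fun k => _) = (fun k => \int[nu]_y (q \_ (~` eball x (u k))) y)); last first.
  by apply/funext => k; rewrite split_q// Rintegral_mkcond.
have mr k : measurable_fun setT (q \_ (~` eball x (u k))).
  have mE := measurable_far x (u k).
  by apply/(measurable_restrictT _ mE); exact: measurable_funTS.
have cvgq : {ae nu, forall y, setT y ->
    (fun k => (EFin \o (q \_ (~` eball x (u k)))) y) @ \oo --> (EFin \o q) y}.
  apply: aeW => y _ /=; apply: cvg_EFin; first exact: nearW.
  have [->|yx] := eqVneq y x.
    have qx : q x = 0 by rewrite /q (subrr x) enorm0 powR0// invr0 mulr0.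
    rewrite (_ : (fun k => _) = (fun=> 0)) ?qx; first exact: cvg_cst.
    by apply/funext => k /=; rewrite patchE; case: ifP; rewrite ?qx.
  apply: cvg_near_cst.
  have z0 : 0 < enorm (y - x) by rewrite lt_neqAle enorm_ge0 eq_sym enorm_eq0 subr_eq0 yx.
  have /cvgr_lt/(_ _ z0) := ucvg.
  apply: filterS => k uk; rewrite /= patchE mem_set//.
  by rewrite farE ltW.
have domq : {ae nu, forall y k, setT y ->
    (`|(EFin \o (q \_ (~` eball x (u k)))) y| <= (EFin \o g) y)%E}.
  apply: aeW => y k _ /=; rewrite lee_fin patchE; case: ifP => _; first exact: qg.
  by rewrite normr0 (le_trans _ (qg y)).
have [_ _ dc] := @dominated_convergence _ _ R nu setT measurableT
  (fun k => EFin \o (q \_ (~` eball x (u k)))) (EFin \o q) (EFin \o g)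
  (fun k => (measurable_EFinP _ _).2 (mr k)) ((measurable_EFinP _ _).2 mq)
  cvgq ig domq.
rewrite /Rintegral; apply: fine_cvg; rewrite fineK; last exact: integrable_fin_num.
exact: dc.
Qed.

(** The integral counterpart of the comparison at a negative minimum: the set
    [A] contributes at most minus its mass times the smallest kernel value,
    the odd part nothing, and the quadratic part a multiple of the total mass. *)
Lemma principal_value_le (v : 'rV[R]_n -> R) (x a : 'rV[R]_n) (A : set 'rV[R]_n)
    (c b rho M : R) :
  L_2s s v -> 0 <= c -> 0 <= b -> 0 < rho -> 0 < M -> measurable A ->
  A `<=` [set y | rho <= enorm (y - x) <= M] -> (nu A < +oo)%E ->
  (forall y, v x - v y <= - c * \1_A y + linear_part x a 1 y +
                          b * Num.min (enorm (y - x) ^+ 2) 1) ->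
  \forall e \near 0^'+,
    \int[nu]_(y in ~` eball x e) ((v x - v y) / enorm (x - y) `^ p) <=
    - (c / M `^ p * fine (nu A)) + b * kernel_mass.
Proof.
move=> Lv c0 b0 r0 M0 mA AM Afin vle; near=> e.
have e0 : 0 < e by near: e; exact: nbhs_right_gt.
have er : e <= rho by near: e; exact: nbhs_right_le.
have mE := measurable_far x e.
have iA : nu.-integrable (~` eball x e) (EFin \o (fun y => \1_A y)).
  apply: (@integrableS _ _ _ _ setT) => //; apply/integrableP; split.
    exact/measurable_EFinP/measurable_indic.
  rewrite (eq_integral (fun y => (\1_A y)%:E)) => [|y _]; last by rewrite gee0_abs// lee_fin.
  by rewrite integral_indic// setIT.
have ik : nu.-integrable (~` eball x e) (EFin \o kernel x).
  by apply: integrableS (integrable_kernel x).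
have il := integrable_linear_part x a 1 e e0 ltr01.
apply: (@le_trans _ _ (- (c / M `^ p) * \int[nu]_(y in ~` eball x e) \1_A y +
    b * \int[nu]_(y in ~` eball x e) kernel x y)).
  apply: (@le_Rintegral_comb _ _ _ nu (~` eball x e)
    (fun y => (v x - v y) / enorm (x - y) `^ p) (fun y => \1_A y) (kernel x)
    (fun y => linear_part x a 1 y / enorm (y - x) `^ p)).
  - exact: mE.
  - exact: integrable_far.
  - exact: iA.
  - exact: ik.
  - exact: il.
  - move=> y; rewrite farE => ey; have z0 : 0 < enorm (y - x) by exact: lt_le_trans ey.
    rewrite (enormBC x y) /kernel.
    apply: le_trans (ler_wpM2r _ (vle y)) _; first by rewrite invr_ge0 powR_ge0.
    set Z := enorm (y - x) `^ p; rewrite 2!mulrDl -(mulrA b) lerD2r lerD2r.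
    rewrite indicE; have [yA|_] /= := boolP (y \in A); last by rewrite !(mul0r, mulr0).
    rewrite !mulr1 mulNr lerN2 ler_wpM2l// /Z lef_pV2 ?posrE ?powR_gt0//.
    move: yA; rewrite inE => /AM /andP[_ yM].
    by apply: ge0_ler_powR; rewrite ?nnegrE ?(ltW p0) ?(ltW M0) ?enorm_ge0.
  - exact: Rintegral_linear_part.
have -> : \int[nu]_(y in ~` eball x e) \1_A y = fine (nu A).
  rewrite /Rintegral integral_indic// setIidl// => y /AM /andP[ry _].
  by rewrite farE (le_trans er).
rewrite mulNr lerD2l ler_wpM2l// /Rintegral.
rewrite -lee_fin fineK; last exact: integrable_fin_num.
apply: le_trans (integral_kernel_le x).
apply: ge0_subset_integral => //.
- by apply/measurable_EFinP; exact: measurable_kernel.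
- by move=> y _; rewrite lee_fin kernel_ge0.
Unshelve. all: by end_near.
Qed.

End principal_value.

(** * First order expansion *)

Section taylor.
Context {R : realType} {n : nat}.
Implicit Types (v : 'rV[R]_n -> R) (x y z : 'rV[R]_n).

Lemma derive_gradient v x z : differentiable v x ->
  'D_z v x = \sum_i gradient v x ord0 i * z ord0 i.
Proof.
move=> dv; rewrite deriveE// {1}(row_sum_delta z) linear_sum; apply: eq_bigr => i _.
by rewrite linearZ /= mxE deriveE// mulrC.
Qed.

Lemma is_derive_line v x z (t : R) : differentiable v (x + t *: z) ->
  is_derive t 1 (fun t => v (x + t *: z)) (\sum_i gradient v (x + t *: z) ord0 i * z ord0 i).
Proof.
move=> dv; rewrite -derive_gradient//.
have E : (fun h : R => h^-1 *: ((fun t => v (x + t *: z)) (h *: 1 + t) - v (x + t *: z))) =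
    (fun h => h^-1 *: (v (h *: z + (x + t *: z)) - v (x + t *: z))).
  apply/funext => h; congr (_ *: (v _ - _)).
  by rewrite scalerDl addrCA; congr (_ *: _ + _); exact: mulr1.
have dz : derivable v (x + t *: z) z by exact: diff_derivable.
split; first by rewrite /derivable E.
by rewrite /derive E.
Qed.

(** By the mean value theorem on the segment from [x] to [y] the remainder is the
    increment of the gradient along the segment, which is Lipschitz on a closed
    ball inside the domain. *)
Lemma C11_loc_taylor v x0 x (r : R) : C11_loc (eball x0 r) v -> eball x0 r x ->
  exists rho C, [/\ 0 < rho, 0 <= C & forall y, enorm (y - x) < rho ->
    `|v y - v x - \sum_i gradient v x ord0 i * (y - x) ord0 i| <= C * enorm (y - x) ^+ 2].
Proof.
move=> [dv lip]; rewrite /eball /= => xr.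
set rho := (r - enorm (x - x0)) / 2.
have rho0 : 0 < rho by rewrite divr_gt0// subr_gt0.
have Kr : [set y | enorm (y - x) <= rho] `<=` eball x0 r.
  move=> y /= yx; rewrite /eball /=.
  have := enorm_triangle y x x0; move: yx; rewrite /rho; lra.
have [L hL] := lip _ (compact_eball_le x rho) Kr.
exists rho, `|L|; split => // y yx; set z := y - x in yx *.
pose g t := v (x + t *: z).
have inK (t : R) : t \in `[0, 1] -> enorm (x + t *: z - x) <= rho.
  rewrite in_itv /= => /andP[t0 t1]; rewrite addrAC subrr add0r enormZ ger0_norm//.
  by rewrite (le_trans _ (ltW yx))// ler_piMl// enorm_ge0.
have dg (t : R) : t \in `[0, 1] ->
    is_derive t 1 g (\sum_i gradient v (x + t *: z) ord0 i * z ord0 i).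
  by move=> t01; apply: is_derive_line; apply: dv; apply: Kr; exact: inK.
have cg : {within `[0, 1], continuous g}.
  by apply: derivable_within_continuous => t t01; exact: (@ex_derive _ _ _ _ _ _ _ (dg t t01)).
have [c c01] := @MVT R g _ 0 1 ltr01 (fun t t01 => dg t (subset_itv_oo_cc t01)) cg.
have {}c01 := subset_itv_oo_cc c01.
rewrite /g scale1r scale0r addr0 subr0 mulr1 (_ : x + z = y); last by rewrite /z subrKC.
move=> ->; rewrite -sumrB.
have -> : \sum_i (gradient v (x + c *: z) ord0 i * z ord0 i - gradient v x ord0 i * z ord0 i)
    = \sum_i (gradient v (x + c *: z) - gradient v x) ord0 i * z ord0 i.
  by apply: eq_bigr => i _; rewrite -mulrBl !mxE.
apply: le_trans (enorm_CS _ _) _; rewrite expr2 mulrA ler_wpM2r ?enorm_ge0//.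
have xK : enorm (x - x) <= rho by rewrite subrr enorm0 ltW.
apply: le_trans (hL _ _ (inK _ c01) xK) _.
rewrite (@le_trans _ _ (`|L| * enorm (x + c *: z - x)))//.
  by rewrite ler_wpM2r ?enorm_ge0// ler_norm.
rewrite ler_wpM2l// addrAC subrr add0r enormZ.
by move: c01; rewrite in_itv/= => /andP[c0 c1]; rewrite ger0_norm// ler_piMl// enorm_ge0.
Qed.

End taylor.

(** * Minima of lower semicontinuous functions *)

Lemma lsc_compact_min {R : realType} {T : topologicalType} (K : set T) (f : T -> R) :
  compact K -> K !=set0 ->
  (forall x, K x -> forall a, a < f x -> \forall y \near within K (nbhs x), a < f y) ->
  exists2 x, K x & forall y, K y -> f x <= f y.
Proof.
move=> cK [x0 Kx0] lsc.
(* The sublevel sets through points of [K] form a filter base of subsets of [K]. *)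
pose B x := [set y | K y /\ f y <= f x].
have FB : ProperFilter (filter_from K B).
  apply: filter_from_proper; last by move=> x Kx; exists x; split.
  apply: filter_from_filter; first by exists x0.
  move=> x y Kx Ky; have [xy|yx] := leP (f x) (f y).
    by exists x => // z [Kz zx]; split; split => //; exact: le_trans xy.
  by exists y => // z [Kz zx]; split; split => //; exact: le_trans (ltW yx).
have FK : filter_from K B K by exists x0 => // y [].
have [p [Kp clp]] := cK _ FB FK.
exists p => // y Ky; rewrite leNgt; apply/negP => fyp.
have Fy : filter_from K B (B y) by exists y.
have [q [[Kq qy] pq]] := clp _ _ Fy (lsc p Kp _ fyp).
by have := pq Kq; rewrite ltNge qy.
Qed.

(** * The Marchaud derivative *)

Section marchaud_bound.
Context {R : realType} (alpha : R).
Hypothesis halpha : 0 < alpha < 1.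

Definition marchaud_mass : R := kernel_bound 2 (1 + alpha) 1 1.

Lemma marchaud_mass_ge0 : 0 <= marchaud_mass.
Proof.
move: halpha => /andP[a0 a1]; apply: kernel_bound_ge0 => //.
  by rewrite ltrDl.
by rewrite natrD; lra.
Qed.

Lemma integral_time_kernel_le (t : R) :
  (\int[lebesgue_measure]_tau
     (Num.min `|t - tau| 1 / `|t - tau| `^ (1 + alpha))%:E <= marchaud_mass%:E)%E.
Proof.
move: halpha => /andP[a0 a1].
apply: (@kernel_integral_le R _ _ (@lebesgue_measure R) (fun tau => `|t - tau|) 2 (1 + alpha) 1 1).
- by apply: measurableT_comp => //; exact: measurable_subl.
- by [].
- by [].
- by rewrite ltrDl.
- by rewrite natrD; lra.
move=> q q0; rewrite (_ : mkset _ = `[t - q, t + q]%classic); last first.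
  apply/seteqP; split => tau; rewrite /= in_itv/= ler_distlC//.
have itvE : lebesgue_measure (`[t - q, t + q]%classic : set R) = (2 * q)%:E.
  rewrite lebesgue_measure_itv/= lte_fin ifT; last by rewrite ltrBlDr -addrA ltrDl addr_gt0.
  by rewrite -EFinD; congr EFin; ring.
by rewrite expr1 -itvE.
Qed.

Lemma Gamma_ge0 (z : R) : 0 <= Gamma z.
Proof. by apply: Rintegral_ge0 => x _; rewrite mulr_ge0 ?powR_ge0 ?expR_ge0. Qed.

Definition marchaud_const : R := alpha / Gamma (1 - alpha).

Lemma marchaud_const_ge0 : 0 <= marchaud_const.
Proof. by move: halpha => /andP[a0 _]; rewrite divr_ge0 ?Gamma_ge0 ?ltW. Qed.

(** Only the positive part of the integrand needs to be controlled: when the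
    integral is not finite its real value is [0], which the nonnegative bound
    still dominates. *)
Lemma marchaud_le (g : R -> R) (t C : R) :
  measurable_fun setT g -> 0 <= C ->
  (forall tau, tau < t -> g t - g tau <= C * Num.min (t - tau) 1) ->
  marchaud alpha g t <= marchaud_const * (C * marchaud_mass).
Proof.
move=> mg C0 gle; rewrite /marchaud ler_wpM2l ?marchaud_const_ge0//.
have CM0 : 0 <= C * marchaud_mass by rewrite mulr_ge0// marchaud_mass_ge0.
suff : (\int[lebesgue_measure]_(tau in `]-oo, t[)
    ((g t - g tau) / (t - tau) `^ (1 + alpha))%:E <= (C * marchaud_mass)%:E)%E.
  by rewrite /Rintegral; case: (integral _ _ _) => [r||] //=; rewrite ?lee_fin.
pose k (tau : R) := Num.min `|t - tau| 1 / `|t - tau| `^ (1 + alpha).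
have k0 tau : 0 <= k tau by rewrite divr_ge0 ?powR_ge0// le_min normr_ge0 ler01.
have msub : measurable_fun setT (fun tau : R => t - tau) by exact: measurable_subl.
have mpow (h : R -> R) : measurable_fun setT h ->
    measurable_fun setT (fun tau => (h tau `^ (1 + alpha))^-1).
  move=> mh; have -> : (fun tau => (h tau `^ (1 + alpha))^-1) = (fun tau => h tau `^ (- (1 + alpha))).
    by apply/funext => y; rewrite powRN.
  exact: measurableT_comp (measurable_powR _) mh.
have mabs : measurable_fun setT (fun tau : R => `|t - tau|) by exact: measurableT_comp.
have mk : measurable_fun setT k.
  by apply: measurable_funM; [exact: measurable_minr|exact: mpow].
have mf : measurable_fun setT (fun tau => (g t - g tau) / (t - tau) `^ (1 + alpha)).
  by apply: measurable_funM; [exact: measurable_funB|exact: mpow].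
have mI : measurable (`]-oo, t[%classic : set R) by exact: measurable_itv.
rewrite integralE; apply: (@le_trans _ _ (\int[lebesgue_measure]_(tau in `]-oo, t[)
    (fun tau => ((g t - g tau) / (t - tau) `^ (1 + alpha))%:E)^\+ tau)%E).
  by rewrite geeDl// oppe_le0 integral_ge0.
apply: (@le_trans _ _ (\int[lebesgue_measure]_(tau in `]-oo, t[) (C%:E * (k tau)%:E))%E).
  apply: ge0_le_integral => //.
  - by apply: measurable_funepos; apply/measurable_EFinP; exact: measurable_funTS.
  - by apply: measurable_funeM; apply/measurable_EFinP; exact: measurable_funTS.
  move=> tau /=; rewrite in_itv/= => taut; rewrite funeposE ge_max.
  have tt : 0 < t - tau by rewrite subr_gt0.
  rewrite -EFinM !lee_fin mulr_ge0// andbT /k ger0_norm ?(ltW tt)// mulrA.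
  by rewrite ler_wpM2r ?invr_ge0 ?powR_ge0// gle.
rewrite ge0_integralZl//; last 2 first.
- by apply/measurable_EFinP; exact: measurable_funTS.
- by move=> tau _; rewrite lee_fin; exact: k0.
rewrite EFinM lee_wpmul2l ?lee_fin//.
apply: le_trans (integral_time_kernel_le t).
apply: ge0_subset_integral => //; first by apply/measurable_EFinP.
by move=> tau _; rewrite lee_fin; exact: k0.
Qed.

End marchaud_bound.

(** * Negative minima in a cylinder *)

Section barrier_minimum.
Context {R : realType} {n : nat}.
Implicit Types (u h : 'rV[R]_n -> R -> R) (x : 'rV[R]_n).

Lemma C1_segment_near (a b : R) (g : R -> R) (t e : R) :
  C1_segment a b g -> t \in `[a, b] -> 0 < e ->
  \forall tau \near t, tau \in `[a, b] -> `|g tau - g t| < e.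
Proof.
move=> [g' [_ dg]] tab e0.
have /cvgrPdist_lt/(_ 1 ltr01) := dg t tab.
rewrite near_withinE => H.
have : \forall tau \near t^', (tau \in `[a, b] -> `|g' t - (g tau - g t) / (tau - t)| < 1).
  by apply: filterS H => tau h tI; exact: h tI.
rewrite near_withinE => {}H.
set l := g' t in H; have l0 : 0 < `|l| + 1 by rewrite ltr_wpDl.
have el : 0 < e / (`|l| + 1) by rewrite divr_gt0.
have N : \forall tau \near t, `|tau - t| < e / (`|l| + 1).
  apply/nbhs_ballP; exists (e / (`|l| + 1)) => //= tau; by rewrite /ball /= distrC.
apply: filterS2 H N => tau q1 td tauab.
have [->|taut] := eqVneq tau t; first by rewrite subrr normr0.
have {}q1 := q1 taut tauab.
have t0 : tau - t != 0 by rewrite subr_eq0.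
rewrite -(divfK t0 (g tau - g t)) normrM.
have qb : `|(g tau - g t) / (tau - t)| <= `|l| + 1.
  have := ler_distD l ((g tau - g t) / (tau - t)) 0; rewrite !subr0 => h.
  by rewrite (le_trans h)// addrC lerD2l distrC ltW.
rewrite (le_lt_trans (ler_wpM2r _ qb))//.
by rewrite mulrC -ltr_pdivlMr.
Qed.

(** On the lateral and the bottom boundary of the cylinder [u] is nonnegative and
    [h] vanishes. Hence the negative part of [u - h], extended by [0] to these
    boundaries, is lower semicontinuous on the compact closed cylinder, and a
    point where it attains a negative minimum lies off them. *)
Lemma negative_minimum u h x0 (r t1 t2 : R) :
  (forall x t e, eball x0 r x -> t \in `[t1, t2] -> 0 < e ->
     \forall tau \near t, tau \in `[t1, t2] -> `|u x tau - u x t| < e) ->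
  lsc_in_x (closure (eball x0 r)) `]t1, t2]%classic u ->
  continuous (fun q : 'rV[R]_n * R => h q.1 q.2) ->
  (forall x t, ~ eball x0 r x -> t1 < t <= t2 -> 0 <= u x t) ->
  (forall x, eball x0 r x -> 0 <= u x t1) ->
  (forall x t, ~ eball x0 r x -> h x t = 0) ->
  (forall x, h x t1 = 0) ->
  (exists x t, [/\ eball x0 r x, t1 < t <= t2 & u x t - h x t < 0]) ->
  exists x t, [/\ eball x0 r x, t1 < t <= t2, u x t - h x t < 0 &
    forall y tau, eball x0 r y -> t1 < tau <= t2 -> u x t - h x t <= u y tau - h y tau].
Proof.
move=> cu lscu ch uout ubot hout hbot [xs [ts [xsB tsJ Uneg]]].
pose I (q : 'rV[R]_n * R) := `[< eball x0 r q.1 >] && (t1 < q.2 <= t2).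
pose U (q : 'rV[R]_n * R) := u q.1 q.2 - h q.1 q.2.
pose g q := if I q then Num.min (U q) 0 else 0.
have g0 q : g q <= 0 by rewrite /g; case: ifP => _ //; rewrite ge_min lexx orbT.
pose K := closure (eball x0 r) `*` `[t1, t2]%classic.
have cK : compact K.
  by apply: compact_setX; [exact: compact_closure_eball|exact: segment_compact].
have IK q : I q -> K q.
  move=> /andP[/asboolP qB /andP[q1 q2]]; split; first exact: subset_closure.
  by rewrite /= in_itv/= (ltW q1).
have Is : I (xs, ts) by apply/andP; split => //; exact/asboolP.
have [|[x t] Kxt gmin] := lsc_compact_min K g cK (ex_intro _ _ (IK _ Is)).
  move=> [x t] [xB tI] a ag; have a0 : a < 0 by exact: lt_le_trans ag (g0 _).
  rewrite /= in xB tI.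
  set e := (g (x, t) - a) / 4.
  have e0 : 0 < e by rewrite divr_gt0// subr_gt0.
  pose m := if `[< eball x0 r x >] then u x t else 0.
  have gm : g (x, t) <= m - h x t.
    rewrite /g /I /= /m; case: asboolP => xb /=; last by rewrite hout// subrr.
    case: ifPn => [_|tn]; first by rewrite ge_min lexx.
    have tt : t = t1.
      move: tn tI; rewrite in_itv/= => + /andP[h1 h2].
      by rewrite h2 andbT -leNgt => h3; apply/eqP; rewrite eq_le h1 h3.
    by rewrite tt hbot subr0 ubot.
  have N2 : \forall tau \near t, t1 < tau <= t2 -> m - e < u x tau.
    rewrite /m; case: asboolP => xb; last first.
      apply: (@nearW _ (nbhs t)) => tau tauJ; rewrite sub0r (lt_le_trans _ (uout _ _ xb tauJ))//.
      by rewrite oppr_lt0.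
    have := cu x t e xb tI e0; apply: filterS => tau + /andP[h1 h2].
    rewrite in_itv/= (ltW h1) h2 => /(_ erefl).
    by rewrite ltr_norml ltrBrDl => /andP[].
  have := lscu x xB e e0; rewrite near_withinE => N1.
  have N3 : \forall q \near (x, t), h q.1 q.2 < h x t + e.
    have FF : Filter (nbhs (x, t)) by exact: nbhs_filter.
    have := ch (x, t); move/(@cvgr_lt _ _ _ FF); apply; by rewrite ltrDl.
  rewrite near_withinE; near=> q => Kq.
  rewrite /g; case: ifPn => // Iq.
  rewrite lt_min a0 andbT /U.
  have /andP[_ qJ] := Iq.
  have h1 : u x q.2 - e < u q.1 q.2.
    have P1 : closure (eball x0 r) q.1 ->
        forall t, `]t1, t2]%classic t -> u x t - e < u q.1 t.
      near: q; exact: cvg_fst N1.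
    by apply: P1; [case: Kq|rewrite /= in_itv].
  have h2 : m - e < u x q.2.
    have : t1 < q.2 <= t2 -> m - e < u x q.2 by near: q; exact: cvg_snd N2.
    exact.
  have h3 : h q.1 q.2 < h x t + e by near: q.
  have ee : e * 4 = g (x, t) - a by rewrite /e divfK.
  lra.
have gs : g (xs, ts) < 0 by rewrite /g Is gt_min Uneg.
have gx : g (x, t) < 0 by exact: le_lt_trans (gmin _ (IK _ Is)) gs.
have Ix : I (x, t) by move: gx; rewrite /g; case: ifP => // _; rewrite ltxx.
have Ux : g (x, t) = U (x, t).
  move: gx; rewrite /g Ix gt_min ltxx orbF => Ux0.
  by apply/eqP; rewrite eq_minl ltW.
have /andP[/asboolP xB tJ] := Ix.
exists x, t; split => //; first by rewrite -[X in X < _]/(U (x, t)) -Ux.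
move=> y tau yB tauJ; rewrite -[X in X <= _]/(U (x, t)) -Ux.
have Iy : I (y, tau) by apply/andP; split => //; exact/asboolP.
by rewrite (le_trans (gmin _ (IK _ Iy)))// /g Iy ge_min lexx.
Unshelve. all: by end_near.
Qed.

End barrier_minimum.

(** * The barrier and the constants *)

Section barrier.
Context {R : realType} {n : nat}.
Implicit Types (x y : 'rV[R]_n) (D : set 'rV[R]_n).

Definition cap x0 (r : R) x : R := Num.max 0 (1 - enorm (x - x0) ^+ 2 / r ^+ 2).

Definition ramp (t1 T t : R) : R := Num.max 0 ((t - t1) / T).

Lemma cap_ge0 x0 r x : 0 <= cap x0 r x.
Proof. by rewrite le_max lexx. Qed.

Lemma cap_le1 x0 r x : cap x0 r x <= 1.
Proof. by rewrite ge_max ler01 gerBl divr_ge0 ?sqr_ge0. Qed.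

Lemma cap_out x0 r x : 0 < r -> ~ eball x0 r x -> cap x0 r x = 0.
Proof.
move=> r0 /negP; rewrite /eball /= -leNgt => rx; apply/max_idPl.
rewrite subr_le0 ler_pdivlMr ?exprn_gt0// mul1r.
by rewrite lerXn2r ?nnegrE ?enorm_ge0 ?(ltW r0).
Qed.

Lemma continuous_cap x0 r : continuous (cap x0 r).
Proof.
move=> x; apply: (@continuous_max _ _ (fun=> 0) (fun x => 1 - enorm (x - x0) ^+ 2 / r ^+ 2)).
  exact: cst_continuous.
apply: continuousB; first exact: cst_continuous.
apply: (@continuousM _ _ (fun x => enorm (x - x0) ^+ 2) (fun=> (r ^+ 2)^-1)).
  by apply: (@continuousM _ _ (fun x => enorm (x - x0)) (fun x => enorm (x - x0)));
    exact: continuous_enormB.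
exact: cst_continuous.
Qed.

(** At an interior point [x] the cap is a concave paraboloid, and everywhere it
    is at least that paraboloid. Going from [x] to [y] it therefore decreases by
    at most a linear term, invisible to the principal value, plus a quadratic
    one. A minimum only requires this one-sided estimate, which is why a cap
    with a kink on the sphere can serve as barrier. *)
Lemma cap_increment x0 r x y : 0 < r -> eball x0 r x ->
  cap x0 r x - cap x0 r y <=
  linear_part x ((2 / r ^+ 2) *: (x - x0)) 1 y +
  (1 + (r ^+ 2)^-1) * Num.min (enorm (y - x) ^+ 2) 1.
Proof.
move=> r0 xr; have r2 : 0 < r ^+ 2 by rewrite exprn_gt0.
rewrite /linear_part indicE; have [yx|yx] := boolP (y \in eball x 1); last first.
  have {}yx : 1 <= enorm (y - x) by move: yx; rewrite notin_setE /eball /= => /negP; rewrite -leNgt.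
  rewrite mul0r add0r /Num.min ltNge exprn_ege1//= mulr1.
  have := cap_le1 x0 r x; have := cap_ge0 x0 r y.
  have : 0 <= (r ^+ 2)^-1 by rewrite invr_ge0 ltW.
  by move=> ? ? ?; lra.
move: yx; rewrite inE /eball /= => yx.
rewrite mul1r; have -> : Num.min (enorm (y - x) ^+ 2) 1 = enorm (y - x) ^+ 2.
  by apply/min_idPl; rewrite exprn_ile1 ?enorm_ge0// ltW.
have bx : cap x0 r x = 1 - enorm (x - x0) ^+ 2 / r ^+ 2.
  apply/max_idPr; rewrite subr_ge0 ler_pdivrMr// mul1r.
  by rewrite lerXn2r ?nnegrE ?enorm_ge0 ?(ltW r0) ?(ltW xr).
have by_ : 1 - enorm (y - x0) ^+ 2 / r ^+ 2 <= cap x0 r y by rewrite le_max lexx orbT.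
have ex : enorm (y - x0) ^+ 2 = enorm (x - x0) ^+ 2 +
    2 * (\sum_i (x - x0) ord0 i * (y - x) ord0 i) + enorm (y - x) ^+ 2.
  rewrite !sqr_enorm mulr_sumr -!big_split/=; apply: eq_bigr => i _.
  by rewrite !mxE; ring.
have -> : \sum_i ((2 / r ^+ 2) *: (x - x0)) ord0 i * (y - x) ord0 i =
    2 * (\sum_i (x - x0) ord0 i * (y - x) ord0 i) / r ^+ 2.
  by rewrite mulr_sumr mulr_suml; apply: eq_bigr => i _; rewrite !mxE; ring.
have z0 : 0 <= enorm (y - x) ^+ 2 by exact: sqr_ge0.
rewrite bx; apply: le_trans (lerB (lexx _) by_) _; rewrite ex.
rewrite !mulrDl mul1r; set A := _ / _; set B := _ / _; rewrite (mulrC _^-1).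
by set C := _ / _; lra.
Qed.

Lemma linear_partZ x (k : R) (a : 'rV[R]_n) rho y :
  linear_part x (k *: a) rho y = k * linear_part x a rho y.
Proof.
rewrite /linear_part mulrCA; congr (_ * _); rewrite mulr_sumr.
by apply: eq_bigr => i _; rewrite mxE mulrA.
Qed.

Lemma ramp_ge0 (t1 T t : R) : 0 <= ramp t1 T t.
Proof. by rewrite le_max lexx. Qed.

Lemma ramp_before (t1 T t : R) : 0 < T -> t <= t1 -> ramp t1 T t = 0.
Proof. by move=> T0 tt; apply/max_idPl; rewrite pmulr_lle0 ?invr_gt0// subr_le0. Qed.

Lemma ramp_le2 (t1 T t : R) : 0 < T -> t <= t1 + T + T -> ramp t1 T t <= 2.
Proof.
by move=> T0 tt; rewrite ge_max ler0n ler_pdivrMr//; lra.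
Qed.

Lemma continuous_ramp (t1 T : R) : continuous (ramp t1 T).
Proof.
move=> t; apply: (@continuous_max _ _ (fun=> 0) (fun t => (t - t1) / T)).
  exact: cvg_cst.
by apply: cvgM; [apply: cvgB; [exact: cvg_id|exact: cvg_cst]|exact: cvg_cst].
Qed.

Lemma ramp_increment (t1 T t tau : R) : 0 < T -> t1 < t <= t1 + T + T -> tau < t ->
  ramp t1 T t - ramp t1 T tau <= (2 + T^-1) * Num.min (t - tau) 1.
Proof.
move=> T0 /andP[t1t t2] taut.
have h1 : ramp t1 T t = (t - t1) / T.
  by apply/max_idPr; rewrite divr_ge0 ?subr_ge0 ?ltW.
have h2 : (tau - t1) / T <= ramp t1 T tau by rewrite le_max lexx orbT.
have h3 := ramp_le2 t1 T t T0 t2; have h4 := ramp_ge0 t1 T tau.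
have T1 : 0 <= T^-1 by rewrite invr_ge0 ltW.
rewrite /Num.min; case: ifPn => _; last by lra.
apply: (@le_trans _ _ (T^-1 * (t - tau))); last first.
  by rewrite ler_wpM2r// ?subr_ge0 ?(ltW taut)// lerDr.
have -> : T^-1 * (t - tau) = (t - t1) / T - (tau - t1) / T by rewrite -mulrBl mulrC; congr (_ * _); ring.
by rewrite h1 lerD2l lerN2.
Qed.

(** A radius within which enough of [D] is found: all of [D] when [D] is bounded,
    and then a function of the diameter and of the distance alone, otherwise
    some radius for which the ball meets [D]. *)
Definition reach D x0 : R :=
  if (ediam D < +oo)%E then epoint_dist x0 D + fine (ediam D)
  else xget 0 [set M | 0 <= M /\ (D `&` eball x0 M) !=set0].

Definition reached D x0 : set 'rV[R]_n := D `&` [set y | enorm (y - x0) <= reach D x0].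

Lemma epoint_dist_ge0 x0 D : D !=set0 -> 0 <= epoint_dist x0 D.
Proof.
move=> [y Dy]; apply: lb_le_inf; first by exists (enorm (x0 - y)); exists y.
by move=> _ [z _ <-]; exact: enorm_ge0.
Qed.

Lemma ediam_ge0 D : D !=set0 -> (0 <= ediam D)%E.
Proof.
move=> [y Dy]; apply: ereal_sup_ubound; exists y => //; exists y => //.
by rewrite subrr enorm0.
Qed.

Lemma reach_bounded D x0 y : (ediam D < +oo)%E -> D y -> enorm (y - x0) <= reach D x0.
Proof.
move=> Dfin Dy; rewrite /reach Dfin -lerBlDr.
have D0 : D !=set0 by exists y.
apply: lb_le_inf; first by exists (enorm (x0 - y)); exists y.
move=> _ [z Dz <-]; rewrite lerBlDr.
apply: le_trans (enorm_triangle y z x0) _; rewrite (enormBC z x0) addrC lerD2l.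
rewrite -lee_fin fineK ?ge0_fin_numE ?ediam_ge0//.
by apply: ereal_sup_ubound; exists y => //; exists z.
Qed.

Lemma reached_bounded D x0 : (ediam D < +oo)%E -> reached D x0 = D.
Proof.
by move=> Dfin; apply/setIidPl => y /= Dy; exact: reach_bounded.
Qed.

Lemma reach_unbounded D x0 : D !=set0 -> ~~ (ediam D < +oo)%E ->
  0 <= reach D x0 /\ (D `&` eball x0 (reach D x0)) !=set0.
Proof.
move=> [y Dy] /negbTE Dfin; rewrite /reach Dfin.
case: xgetP => [M _ //|/(_ (enorm (y - x0) + 1))[]]; split.
  by rewrite addr_ge0 ?enorm_ge0.
by exists y; split => //; rewrite /eball /= ltrDl.
Qed.

Lemma reach_ge0 D x0 : D !=set0 -> 0 <= reach D x0.
Proof.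
move=> D0; have [Dfin|Dinf] := boolP (ediam D < +oo)%E.
  by rewrite /reach Dfin addr_ge0 ?epoint_dist_ge0// fine_ge0 ?ediam_ge0.
by have [] := reach_unbounded D x0 D0 Dinf.
Qed.

Lemma measurable_reached D x0 : open D -> measurable (reached D x0).
Proof.
move=> oD; apply: measurableI; first exact: open_measurable_rV.
exact: measurable_eball_le.
Qed.

Lemma lebesgue_reached_fin D x0 : open D -> D !=set0 -> (lebesgue_rV (reached D x0) < +oo)%E.
Proof.
move=> oD D0; have M1 : 0 < reach D x0 + 1 by rewrite ltr_wpDl// reach_ge0.
apply: le_lt_trans (ltry _); apply: le_trans (lebesgue_rV_eball_le x0 _ M1).
apply: le_measure; rewrite ?inE; [exact: measurable_reached|exact: measurable_eball_le|].
by move=> y [_ /= h]; rewrite (le_trans h)// lerDl.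
Qed.

Lemma lebesgue_reached_gt0 D x0 : open D -> D !=set0 -> (0 < lebesgue_rV (reached D x0))%E.
Proof.
move=> oD D0; have [Dfin|Dinf] := boolP (ediam D < +oo)%E.
  by rewrite reached_bounded//; exact: lebesgue_rV_open_gt0.
have [_ ne] := reach_unbounded D x0 D0 Dinf.
have oB : open (D `&` eball x0 (reach D x0)) by apply: openI => //; exact: open_eball.
apply: lt_le_trans (lebesgue_rV_open_gt0 _ oB ne) _.
apply: le_measure; rewrite ?inE; [exact: open_measurable_rV|exact: measurable_reached|].
by move=> y [Dy /= /ltW].
Qed.

(** The kernel between a point of the ball of radius [r] and a point of
    [reached D x0] is at least [(reach D x0 + r) `^ - (n + 2 s)], so this
    quotient bounds from below the interaction with [D]. The default value [1]
    keeps the constant positive for every set [D]. *)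
Definition interaction (s r : R) D x0 : R :=
  let k := fine (lebesgue_rV (reached D x0)) / (reach D x0 + r) `^ (n%:R + 2 * s) in
  if 0 < k then k else 1.

Lemma interaction_gt0 s r D x0 : 0 < interaction s r D x0.
Proof. by rewrite /interaction; case: ifPn. Qed.

Lemma interactionE s r D x0 : 0 < r -> open D -> D !=set0 ->
  interaction s r D x0 =
  fine (lebesgue_rV (reached D x0)) / (reach D x0 + r) `^ (n%:R + 2 * s).
Proof.
move=> r0 oD D0; rewrite /interaction ifT// divr_gt0//.
  by rewrite fine_gt0// lebesgue_reached_gt0//= lebesgue_reached_fin.
by rewrite powR_gt0// ltr_wpDl// reach_ge0.
Qed.

Lemma interaction_eq s r D D' x0 x0' : (ediam D < +oo)%E ->
  ediam D = ediam D' -> epoint_dist x0 D = epoint_dist x0' D' ->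
  lebesgue_rV D = lebesgue_rV D' -> interaction s r D x0 = interaction s r D' x0'.
Proof.
move=> Dfin dE pE mE; have Dfin' : (ediam D' < +oo)%E by rewrite -dE.
have rE : reach D x0 = reach D' x0' by rewrite /reach Dfin Dfin' dE pE.
rewrite /interaction (reached_bounded D x0 Dfin) (reached_bounded D' x0' Dfin') rE.
by move: (lebesgue_rV D) mE => m ->.
Qed.

End barrier.

(** * Comparison at a negative minimum *)

Section comparison.
Context {R : realType} {n : nat} (alpha s C0 r T t1 t2 delta : R).
Variables (x0 : 'rV[R]_n) (u : 'rV[R]_n -> R -> R).
Hypotheses (halpha : 0 < alpha < 1) (hs : 0 < s < 1) (hC0 : 0 < C0) (hr : 0 < r).
Hypotheses (hT : 0 < T) (ht2 : t2 = t1 + T + T) (hdelta : 0 < delta).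

Definition barrier (x : 'rV[R]_n) (t : R) : R := delta * (cap x0 r x * ramp t1 T t).

Lemma continuous_barrier : continuous (fun q : 'rV[R]_n * R => barrier q.1 q.2).
Proof.
have cc : continuous (fun q : 'rV[R]_n * R => cap x0 r q.1).
  move=> q; apply: (@continuous_comp _ _ _ fst (cap x0 r)); first exact: cvg_fst.
  exact: continuous_cap.
have cr : continuous (fun q : 'rV[R]_n * R => ramp t1 T q.2).
  move=> q; apply: (@continuous_comp _ _ _ snd (ramp t1 T)); first exact: cvg_snd.
  exact: continuous_ramp.
move=> q; apply: (@continuousM _ _ (fun=> delta)
  (fun q : 'rV[R]_n * R => cap x0 r q.1 * ramp t1 T q.2)); first exact: cst_continuous.
exact: (@continuousM _ _ (fun q : 'rV[R]_n * R => cap x0 r q.1) (fun q => ramp t1 T q.2) q (cc q) (cr q)).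
Qed.

Lemma barrier_out x t : ~ eball x0 r x -> barrier x t = 0.
Proof. by move=> xB; rewrite /barrier cap_out// mul0r mulr0. Qed.

Lemma barrier_before x t : t <= t1 -> barrier x t = 0.
Proof. by move=> tt; rewrite /barrier ramp_before// !mulr0. Qed.

Lemma barrier_center t0 : t0 = t1 + T -> barrier x0 t0 = delta.
Proof.
move=> ->; rewrite /barrier; have -> : cap x0 r x0 = 1.
  by rewrite /cap subrr enorm0 expr0n/= mul0r subr0; apply/max_idPr.
have -> : ramp t1 T (t1 + T) = 1.
  by rewrite /ramp addrAC subrr add0r divff ?gt_eqF//; apply/max_idPr.
by rewrite !mulr1.
Qed.

Variables (x : 'rV[R]_n) (t : R).
Hypotheses (xB : eball x0 r x) (tJ : t1 < t <= t2).
Hypothesis neg : u x t - barrier x t < 0.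
Hypothesis is_min : forall y tau, eball x0 r y -> t1 < tau <= t2 ->
  u x t - barrier x t <= u y tau - barrier y tau.

(** The past values of [u - barrier] are all at least its value at the minimum,
    so the increments of [u] are bounded by those of the barrier. *)
Lemma marchaud_at_min : measurable_fun setT (u x) ->
  (forall tau, tau <= t1 -> 0 <= u x tau) ->
  marchaud alpha (u x) t <=
  marchaud_const alpha * (delta * (2 + T^-1) * marchaud_mass alpha).
Proof.
move=> mu upast; have T1 : 0 < 2 + T^-1 by rewrite addr_gt0// invr_gt0.
apply: marchaud_le => //; first by rewrite mulr_ge0// ltW.
move=> tau taut.
have /andP[tt1 tt2] := tJ.
have tJ' : t1 < t <= t1 + T + T by rewrite -ht2.
have incr : barrier x t - barrier x tau <= delta * (2 + T^-1) * Num.min (t - tau) 1.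
  have ri := ramp_increment t1 T t tau hT tJ' taut.
  have m0 : 0 <= (2 + T^-1) * Num.min (t - tau) 1.
    by rewrite mulr_ge0 ?(ltW T1)// le_min subr_ge0 (ltW taut) ler01.
  rewrite /barrier -mulrBr -mulrBr -[leRHS]mulrA ler_pM2l//.
  apply: le_trans (ler_wpM2l (cap_ge0 _ _ _) ri) _.
  by rewrite ler_piMl// cap_le1.
apply: le_trans _ incr.
have [tau1|tau1] := leP tau t1.
  rewrite (barrier_before x tau tau1) subr0.
  by have := upast tau tau1; move: neg; lra.
have tauJ : t1 < tau <= t2 by rewrite tau1 (le_trans (ltW taut)).
by have := is_min x tau xB tauJ; lra.
Qed.

Variable D : set 'rV[R]_n.
Hypotheses (oD : open D) (D0 : D !=set0) (BD : eball x0 r `&` closure D = set0).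
Hypothesis uD : forall y, D y -> C0 <= u y t.
Hypothesis uout : forall y, ~ eball x0 r y -> 0 <= u y t.

Let Dout y : D y -> ~ eball x0 r y.
Proof.
move=> Dy yB; have : (eball x0 r `&` closure D) y by split => //; exact: subset_closure.
by rewrite BD.
Qed.

(** The values of [u - barrier] at time [t] are at least its negative value at
    [x]: inside the ball by minimality, outside because [u] is nonnegative, and
    on [D] with the margin [C0]. *)
Lemma increment_at_min y :
  u x t - u y t <= - C0 * \1_(reached D x0) y +
    linear_part x ((delta * ramp t1 T t) *: ((2 / r ^+ 2) *: (x - x0))) 1 y +
    2 * delta * (1 + (r ^+ 2)^-1) * Num.min (enorm (y - x) ^+ 2) 1.
Proof.
have step : u x t - u y t <= - C0 * \1_(reached D x0) y + (barrier x t - barrier y t).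
  rewrite indicE; have [yA|_] /= := boolP (y \in reached D x0).
    move: yA; rewrite inE => -[Dy _].
    by rewrite (barrier_out y t (Dout y Dy)) mulr1; have := uD y Dy; move: neg; lra.
  rewrite mulr0 add0r; have [yB|yB] := pselect (eball x0 r y).
    by have := is_min y t yB tJ; lra.
  by rewrite (barrier_out y t yB); have := uout y yB; move: neg; lra.
apply: le_trans step _; rewrite -addrA lerD2l linear_partZ.
have /andP[_ tt2] := tJ; rewrite ht2 in tt2.
have r0 := ramp_ge0 t1 T t; have r2 := ramp_le2 t1 T t hT tt2.
have bi := cap_increment x0 r x y hr xB.
have dr : 0 <= delta * ramp t1 T t by rewrite mulr_ge0// ltW.
have -> : barrier x t - barrier y t = delta * ramp t1 T t * (cap x0 r x - cap x0 r y).
  by rewrite /barrier; ring.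
apply: le_trans (ler_wpM2l dr bi) _; rewrite mulrDr lerD2l !mulrA.
have m0 : 0 <= Num.min (enorm (y - x) ^+ 2) 1 by rewrite le_min sqr_ge0 ler01.
rewrite ler_wpM2r// ler_wpM2r ?addr_ge0 ?invr_ge0 ?sqr_ge0//.
by rewrite mulrC ler_pM2r.
Qed.

(** The regularity of [u] serves only to give a meaning to the principal value;
    its size comes from the increments at the minimum. *)
Lemma frac_laplacian_at_min (Cns : R) : 0 < Cns ->
  C11_loc (eball x0 r) (u^~ t) -> L_2s s (u^~ t) ->
  frac_laplacian Cns s (u^~ t) x <=
  Cns * (- (C0 * interaction s r D x0) +
         2 * delta * (1 + (r ^+ 2)^-1) * @kernel_mass R n s).
Proof.
move=> hCns c11 L2s; rewrite /frac_laplacian ler_pM2l//.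
have [rho [C [rho0 Cge0 taylor]]] := C11_loc_taylor (u^~ t) x0 x r c11 xB.
have pvc := principal_value_cvg s hs (u^~ t) x _ C rho L2s rho0 Cge0 taylor.
have xr : 0 < r - enorm (x - x0) by rewrite subr_gt0.
have M0 : 0 < reach D x0 + r by rewrite ltr_wpDl// reach_ge0.
have AM : reached D x0 `<=` [set y | r - enorm (x - x0) <= enorm (y - x) <= reach D x0 + r].
  move=> y [Dy /= yM]; apply/andP; split.
    have /negP := Dout y Dy; rewrite /eball /= -leNgt => ry.
    by rewrite lerBlDr (le_trans ry)// enorm_triangle.
  apply: le_trans (enorm_triangle y x0 x) _.
  by rewrite lerD// enormBC ltW.
have b0 : 0 <= 2 * delta * (1 + (r ^+ 2)^-1).
  by rewrite mulr_ge0 ?mulr_ge0 ?(ltW hdelta)// addr_ge0// invr_ge0 sqr_ge0.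
have pvl := principal_value_le s hs (u^~ t) x _ (reached D x0) C0 _ _ _ L2s (ltW hC0) b0
  xr M0 (measurable_reached D x0 oD) AM (lebesgue_reached_fin D x0 oD D0) increment_at_min.
rewrite (interactionE s r D x0 hr oD D0).
apply: limr_le; first exact: pvc.
by apply: filterS pvl => e; rewrite mulrA mulrAC.
Qed.

End comparison.

(** * Averaging effects *)

(* Cns is the normalization constant of the fractional Laplacian. eps0 D x0 and
   C1 D x0 are chosen before t0, eps and u. *)
Theorem theorem1p2 (R : realType) (n : nat) (alpha s Cns C0 r : R)
    (hn : (0 < n)%N) (halpha : 0 < alpha < 1) (hs : 0 < s < 1)
    (hCns : 0 < Cns) (hC0 : 0 < C0) (hr : 0 < r) :
  exists eps0 C1 : set 'rV[R]_n -> 'rV[R]_n -> R,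
    [/\ forall D x0, 0 < eps0 D x0 /\ 0 < C1 D x0,
        forall (D D' : set 'rV[R]_n) (x0 x0' : 'rV[R]_n),
          is_domain D -> is_domain D' -> (ediam D < +oo)%E ->
          ediam D = ediam D' -> epoint_dist x0 D = epoint_dist x0' D' ->
          lebesgue_rV D = lebesgue_rV D' ->
          eps0 D x0 = eps0 D' x0' /\ C1 D x0 = C1 D' x0' &
        forall (D : set 'rV[R]_n) (x0 : 'rV[R]_n) (t0 eps : R)
               (u : 'rV[R]_n -> R -> R),
          let t1 := t0 - r `^ (2 * s / alpha) in
          let t2 := t0 + r `^ (2 * s / alpha) in
          is_domain D ->
          eball x0 r `&` closure D = set0 ->
          (forall x t, D x -> t1 < t <= t2 -> C0 <= u x t) ->
          (forall t, t1 < t <= t2 ->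
             C11_loc (eball x0 r) (u^~ t) /\ L_2s s (u^~ t)) ->
          (forall x, eball x0 r x ->
             C1_segment t1 t2 (u x) /\ L_alpha_minus alpha (u x)) ->
          lsc_in_x (closure (eball x0 r)) `]t1, t2]%classic u ->
          0 < eps <= eps0 D x0 ->
          (forall x t, eball x0 r x -> t1 < t <= t2 ->
             - eps <= marchaud alpha (u x) t
                      + frac_laplacian Cns s (u^~ t) x) ->
          (forall x t, ~ eball x0 r x -> t1 < t <= t2 -> 0 <= u x t) ->
          (forall x t, eball x0 r x -> t <= t1 -> 0 <= u x t) ->
          C1 D x0 <= u x0 t0].
Proof.
set T := r `^ (2 * s / alpha).
have T0 : 0 < T by rewrite powR_gt0.
set b := 1 + (r ^+ 2)^-1; set cT := 2 + T^-1.
have b0 : 0 <= b by rewrite addr_ge0// invr_ge0 sqr_ge0.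
have cT0 : 0 <= cT by rewrite addr_ge0// invr_ge0 ltW.
have K0 : 0 <= @kernel_mass R n s.
  move: hs => /andP[s0 s1]; apply: kernel_bound_ge0; first by rewrite exprn_ge0.
    by rewrite ltrDl mulr_gt0.
  by rewrite natrD; lra.
pose Q := marchaud_const alpha * (cT * marchaud_mass alpha) +
  Cns * (2 * b * @kernel_mass R n s).
have Q0 : 0 <= Q.
  by rewrite addr_ge0// mulr_ge0 ?(ltW hCns) ?marchaud_const_ge0// mulr_ge0 ?marchaud_mass_ge0// mulr_ge0.
(* [delta * Q] is the cost of the barrier of height [delta], and [X] the gain
   from the interaction with [D]. *)
pose X (D : set 'rV[R]_n) (x0 : 'rV[R]_n) : R := Cns * C0 * interaction s r D x0.
have X0 D x0 : 0 < X D x0 by rewrite !mulr_gt0// interaction_gt0.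
have Q1 : 0 < 2 * (Q + 1) by rewrite mulr_gt0// ltr_wpDl.
(* This height costs less than half of the gain, and [eps] uses up at most the
   other half. *)
exists (fun D x0 => X D x0 / 2), (fun D x0 => X D x0 / (2 * (Q + 1))); split.
- by move=> D x0; rewrite !divr_gt0.
- move=> D D' x0 x0' _ _ Dfin dE pE mE; rewrite /X.
  by rewrite (interaction_eq s r D D' x0 x0' Dfin dE pE mE).
move=> D x0 t0 eps u t1 t2 [D0 oD _] BD uD ux ut lscu /andP[_ epsX] super uout upast.
set delta := X D x0 / (2 * (Q + 1)).
have delta0 : 0 < delta by rewrite divr_gt0.
rewrite leNgt; apply/negP => ulow.
have t2E : t2 = t1 + T + T by rewrite /t1 /t2 -/T; ring.
have t0E : t0 = t1 + T by rewrite /t1 -/T; ring.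
have xB0 : eball x0 r x0 by rewrite /eball /= subrr enorm0.
have t0J : t1 < t0 <= t2 by rewrite t2E t0E ltrDl T0 lerDl ltW.
have [x [t [xB tJ neg is_min]]] : exists x t, [/\ eball x0 r x, t1 < t <= t2,
    u x t - barrier r T t1 delta x0 x t < 0 &
    forall y tau, eball x0 r y -> t1 < tau <= t2 ->
      u x t - barrier r T t1 delta x0 x t <= u y tau - barrier r T t1 delta x0 y tau].
  apply: negative_minimum.
  - by move=> x t e xB tI e0; apply: C1_segment_near => //; have [] := ut x xB.
  - exact: lscu.
  - exact: continuous_barrier.
  - exact: uout.
  - by move=> x xB; exact: upast.
  - by move=> x t; exact: barrier_out.
  - by move=> x; exact: barrier_before.
  - by exists x0, t0; split => //; rewrite barrier_center ?subr_lt0.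
have [_ [[mu _ _] _]] := ut x xB.
have time := marchaud_at_min alpha r T t1 t2 delta x0 u halpha T0 t2E delta0 x t xB tJ neg
  is_min mu (fun tau => upast x tau xB).
have [c11 L2s] := ux t tJ.
have space := frac_laplacian_at_min s C0 r T t1 t2 delta x0 u hs hC0 hr T0 t2E delta0 x t xB tJ
  neg is_min D oD D0 BD (fun y Dy => uD y t Dy tJ) (fun y yB => uout y t yB tJ) Cns hCns c11 L2s.
have := super x t xB tJ.
have dE : delta * (2 * (Q + 1)) = X D x0 by rewrite divfK// gt_eqF.
have XE : Cns * (C0 * interaction s r D x0) = X D x0 by rewrite /X mulrA.
have QE : delta * Q = marchaud_const alpha * (delta * cT * marchaud_mass alpha) +
    Cns * (2 * delta * b * @kernel_mass R n s) by rewrite /Q; ring.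
move: time space; rewrite -/b -/cT (mulrDr Cns) (mulrN Cns) XE.
move: (marchaud _ _ _) (frac_laplacian _ _ _ _) => A B; lra.
Qed.
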